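(* There is an algorithm which, given a 2-CNF formula $F$ (possibly with repeated occurrences of clauses) with $m$ clauses and a non-negative integer $k$, either outputs a collection of at most $k$ clause occurrences of $F$ whose removal makes $F$ satisfiable, or outputs 'NO' if no such collection exists, and runs in time $O(15^k\cdot k\cdot m^3)$.
   Context: A literal is a Boolean variable or its negation. A 2-CNF formula is a conjunction of clauses, each being a disjunction of at most two literals; here a clause may occur several times in $F$, and removing a collection of clause occurrences means deleting those occurrences from the conjunction. A formula is satisfiable if some truth assignment to its variables makes every clause true.
   Formalization: In the running time the factors k and m are read as max(k,1) and max(m,1), because the literal bound is 0 when k = 0 or m = 0, which no algorithm can meet; for k, m ≥ 1 the bound is the stated one, on a unit-cost random access machine. *)

(* Defs.v *)
From mathcomp Require Export all_boot.

Set Implicit Arguments.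
Unset Strict Implicit.
Unset Printing Implicit Defensive.

(* A literal (x, b) is the variable x if b = true and its negation otherwise. *)
Definition literal : Type := (nat * bool)%type.
Definition clause : Type := seq literal.

(* A conjunction of clauses; clause occurrences are the positions in the list,
   so repeated clauses are distinct occurrences. *)
Definition cnf : Type := seq clause.

Definition is_2cnf (F : cnf) : bool := all (fun c : clause => size c <= 2) F.

Definition lit_true (a : nat -> bool) (l : literal) : bool := a l.1 == l.2.
Definition clause_true (a : nat -> bool) (c : clause) : bool :=
  has (lit_true a) c.
Definition satisfiable (F : cnf) : Prop :=
  exists a : nat -> bool, all (clause_true a) F.

Definition remove_occurrences (F : cnf) (D : seq nat) : cnf :=
  mask [seq i \notin D | i <- iota 0 (size F)] F.

Definition is_deletion_set (F : cnf) (k : nat) (D : seq nat) : Prop :=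
  [/\ uniq D, all (fun i => i < size F) D, size D <= k &
      satisfiable (remove_occurrences F D)].

(* Model of computation: the unit-cost random access machine with addition and
   truncated subtraction (no multiplication), programmed by structured control
   flow instead of jumps.  A program refers to registers by fixed numbers and
   to memory cells by computed addresses; both hold natural numbers.  Evaluating
   an expression costs one step per node, and each assignment, store and test
   costs one further step. *)
Inductive expr : Type :=
  | Const of nat
  | Reg of nat
  | Cell of expr
  | Add of expr & expr
  | Sub of expr & expr.

Inductive prog : Type :=
  | Skip
  | Assign of nat & expr
  | Store of expr & expr
  | Seq of prog & prog
  | If of expr & prog & prog
  | While of expr & prog.

Record state : Type := State { reg : nat -> nat; mem : nat -> nat }.

Definition upd (f : nat -> nat) (i v : nat) : nat -> nat :=
  fun j => if j == i then v else f j.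

Fixpoint eval (s : state) (e : expr) : nat :=
  match e with
  | Const n => n
  | Reg r => reg s r
  | Cell a => mem s (eval s a)
  | Add a b => eval s a + eval s b
  | Sub a b => eval s a - eval s b
  end.

Fixpoint cost (e : expr) : nat :=
  match e with
  | Const _ | Reg _ => 1
  | Cell a => (cost a).+1
  | Add a b | Sub a b => (cost a + cost b).+1
  end.

(* runs p s t s': started in state s, p halts in state s' after t steps.
   Tests succeed on nonzero values. *)
Inductive runs : prog -> state -> nat -> state -> Prop :=
  | RunSkip s : runs Skip s 1 s
  | RunAssign s r e :
      runs (Assign r e) s (cost e).+1
           (State (upd (reg s) r (eval s e)) (mem s))
  | RunStore s a e :
      runs (Store a e) s (cost a + cost e).+1
           (State (reg s) (upd (mem s) (eval s a) (eval s e)))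
  | RunSeq s1 s2 s3 p q t u :
      runs p s1 t s2 -> runs q s2 u s3 -> runs (Seq p q) s1 (t + u) s3
  | RunIfTrue s s' e p q t :
      eval s e != 0 -> runs p s t s' -> runs (If e p q) s (cost e + t).+1 s'
  | RunIfFalse s s' e p q t :
      eval s e = 0 -> runs q s t s' -> runs (If e p q) s (cost e + t).+1 s'
  | RunWhileTrue s1 s2 s3 e p t u :
      eval s1 e != 0 -> runs p s1 t s2 -> runs (While e p) s2 u s3 ->
      runs (While e p) s1 (cost e + t + u).+1 s3
  | RunWhileFalse s e p :
      eval s e = 0 -> runs (While e p) s (cost e).+1 s.

Definition encode_literal (l : literal) : seq nat := [:: l.1; nat_of_bool l.2].

(* Five cells per clause of a 2-CNF formula: the number of its literals, then
   its literals, padded to two. *)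
Definition encode_clause (c : clause) : seq nat :=
  size c :: encode_literal (nth (0, false) c 0)
         ++ encode_literal (nth (0, false) c 1).

(* Register 0 holds k, register 1 the number of clauses; the clauses are laid
   out in memory from address 0.  Everything else is 0. *)
Definition input_state (F : cnf) (k : nat) : state :=
  State (nth 0 [:: k; size F]) (nth 0 (flatten (map encode_clause F))).

(* The answer is NO (None) if register 0 holds 0; otherwise it is the collection
   of positions stored in memory from address 0, register 1 holding its size. *)
Definition output (s : state) : option (seq nat) :=
  if reg s 0 == 0 then None else Some (mkseq (mem s) (reg s 1)).

Definition correct_answer (F : cnf) (k : nat) (o : option (seq nat)) : Prop :=
  match o with
  | Some D => is_deletion_set F k D
  | None => ~ exists D : seq nat, is_deletion_set F k D
  end.

(* Main.v *)
From Stdlib Require Import FunctionalExtensionality Classical.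
From mathcomp Require Import zify.
Require Import Defs.

Set Implicit Arguments.
Unset Strict Implicit.
Unset Printing Implicit Defensive.

(** A clause (a or b) yields the arcs ~a -> b and ~b -> a of a digraph on the
    literals that is symmetric under negation.  A total assignment, seen as its
    set A of true literals, violates half as many nonempty clauses as there are
    arcs leaving A.  For a partial assignment S, the minimum number v of arcs
    leaving a set that contains S and misses the negations of S is therefore a
    lower bound (by v/2) on the cost of every extension, and by uncrossing, the
    least such minimum cut is consistent and may be assigned at no loss.

    The algorithm keeps a maximum flow of value v, as a graph in which the flow
    paths are reversed.  For an unassigned literal l it first tries l, then ~l,
    and accepts the literal if v does not grow.  If both raise v, it follows a
    guessed bit and augments the flow.  Since v is at most 2k when a solution of
    cost k exists, 2k bits suffice, and all 4^k guesses are tried in turn.  In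
    one run every search takes O(m^2) steps, and there are O(m) of them, because
    each one assigns a literal, rejects one, or augments the flow. *)

(** * Cuts of skew-symmetric digraphs *)

(** Skew symmetry turns cuts into assignments: the mirror image of a minimum cut is again a minimum
    cut, so the least one lies inside its own mirror image and cannot contain a literal together
    with its negation. The number of guesses is governed by the gap between [d0 A] for an optimal
    assignment [A] and the current minimum cut: every consulted bit closes it by at least one, and
    each violated clause accounts for two units of it. As [4 ^ k <= 15 ^ k], the bound of the
    theorem leaves slack. Fixing the bits in advance replaces recursion: the machine has no stack,
    and backtracking would have to restore the residual graph. Correctness is therefore argued for a
    relation [run] between guesses and final sets, and the program is shown to realise it; that
    least minimum cuts exist comes from the search itself. *)

(* Literals are coded by [2 x] (negative) and [2 x + 1] (positive). *)
Definition neg (c : nat) : nat := if odd c then c.-1 else c.+1.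

Lemma negK : involutive neg.
Proof.
move=> c; rewrite /neg; case oc: (odd c); last by rewrite /= oc.
by case: c oc => //= c /negbTE->.
Qed.

Lemma neg_neq c : (neg c == c) = false.
Proof. by rewrite /neg; case: ifP => oc; apply/eqP; case: c oc => //= *;
  lia. Qed.

Definition full (A : pred nat) : Prop := forall c, A (neg c) = ~~ A c.
Definition consistent (S : pred nat) : Prop := forall c, S c -> ~~ S (neg c).

Definition cut (S X : pred nat) : Prop :=
  forall c, S c -> X c && ~~ X (neg c).

Definition adjoin (S : pred nat) (l : nat) : pred nat :=
  fun c => S c || (c == l).

Definition outdeg (N : nat) (T H : nat -> nat) (X : pred nat) : nat :=
  \sum_(0 <= e < N) (X (T e) && ~~ X (H e)).

Definition closed (N : nat) (T H : nat -> nat) (X : pred nat) : Prop :=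
  forall e, e < N -> X (T e) -> X (H e).

Lemma outdeg_eq0 N T H X : outdeg N T H X = 0 <-> closed N T H X.
Proof.
rewrite /outdeg; split=> [/eqP|cX].
  rewrite big_mkord sum_nat_eq0 => /forallP h e ltN Xe.
  by have /= := h (Ordinal ltN); rewrite Xe /= eqb0 negbK.
rewrite big_nat big1 // => e /andP[_ ltN].
by case XT: (X (T e)); rewrite ?(cX _ ltN XT).
Qed.

Lemma outdeg_le N T H X : outdeg N T H X <= N.
Proof.
rewrite /outdeg -[leqRHS]subn0 -[leqRHS]muln1 -sum_nat_const_nat.
by apply: leq_sum => e _; apply: leq_b1.
Qed.

Lemma outdeg_submod N T H X Y :
  outdeg N T H (predI X Y) + outdeg N T H (predU X Y)
    <= outdeg N T H X + outdeg N T H Y.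
Proof.
rewrite /outdeg -!big_split; apply: leq_sum => e _ /=.
by case: (X (T e)); case: (X (H e)); case: (Y (T e)); case: (Y (H e)).
Qed.

(** Subtraction-free form of the change [X w - X u]; along a path of reversed arcs these terms
    telescope to the two ends. *)
Lemma outdeg_reverse N T H X e u w : e < N -> T e = u -> H e = w ->
  outdeg N (upd T e w) (upd H e u) X + X u = outdeg N T H X + X w.
Proof.
move=> ltN <- <-; rewrite /outdeg !big_mkord.
rewrite (bigD1 (Ordinal ltN)) //= [in RHS](bigD1 (Ordinal ltN)) //=.
rewrite /upd eqxx; set s1 := \sum_(i < N | _) _; set s2 := \sum_(i < N | _) _.
have -> : s1 = s2.
  apply: eq_bigr => i; rewrite -val_eqE /= => /negPf nei.
  by rewrite nei.
by case: (X (T e)); case: (X (H e)) => /=; lia.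
Qed.

Lemma sub_cut (S S' X : pred nat) :
  (forall c, S c -> S' c) -> cut S' X -> cut S X.
Proof. by move=> sS cX c /sS /cX. Qed.

Lemma cut_adjoin S l X : cut (adjoin S l) X -> cut S X.
Proof. by apply: sub_cut => c; rewrite /adjoin => ->. Qed.

Lemma cut_self S : consistent S -> cut S S.
Proof. by move=> cS c Sc; rewrite Sc cS. Qed.

Lemma cut_predI S X Y : cut S X -> cut S Y -> cut S (predI X Y).
Proof.
by move=> cX cY c Sc /=; case/andP: (cX c Sc) => -> /negPf->;
  case/andP: (cY c Sc) => ->.
Qed.

Lemma cut_predU S X Y : cut S X -> cut S Y -> cut S (predU X Y).
Proof.
by move=> cX cY c Sc /=; case/andP: (cX c Sc) => -> /negPf->;
  case/andP: (cY c Sc) => _ /negPf->.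
Qed.

(** Reversing all arcs and negating all literals maps a skew-symmetric digraph to itself; this is
    the induced map on vertex sets. *)
Definition mirror (X : pred nat) : pred nat := fun c => ~~ X (neg c).

Lemma cut_mirror S X : cut S X -> cut S (mirror X).
Proof.
by move=> cX c Sc; rewrite /mirror negK negbK andbC; apply: cX.
Qed.

Lemma consistent_adjoin S l :
  consistent S -> ~~ S (neg l) -> consistent (adjoin S l).
Proof.
move=> cS nSl c; rewrite /adjoin => /orP[Sc|/eqP->]; last first.
  by rewrite (negPf nSl) neg_neq.
rewrite (negPf (cS c Sc)) /=; apply/eqP => E.
by move: nSl; rewrite -E negK Sc.
Qed.

Section MinimumCuts.

Variables (N : nat) (T0 H0 : nat -> nat).
Local Notation d0 := (outdeg N T0 H0).
Hypothesis skew : forall X, d0 (mirror X) = d0 X.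

Definition least_mincut (S X : pred nat) : Prop :=
  cut S X /\
  forall Y, cut S Y -> d0 X <= d0 Y /\ (d0 Y <= d0 X -> forall c, X c -> Y c).

Lemma least_mincut_unique S X Y :
  least_mincut S X -> least_mincut S Y -> X = Y.
Proof.
move=> [cX mX] [cY mY]; apply: functional_extensionality => c.
have [le1 s1] := mX _ cY; have [le2 s2] := mY _ cX.
by apply/idP/idP; [apply: s1 | apply: s2].
Qed.

(** By skew symmetry [mirror X] is a minimum cut too, so it contains the least one; this inclusion
    is consistency. *)
Lemma least_mincut_consistent S X : least_mincut S X -> consistent X.
Proof.
move=> [cX mX] c Xc; have [_] := mX _ (cut_mirror cX).
by rewrite skew => /(_ (leqnn _) c Xc).
Qed.

(* Uncrossing [A] first with [X] and then with the mirror image of [X] does not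
   increase the cut value. *)
Lemma persistency S X A : consistent X -> cut S X ->
  (forall Y, cut S Y -> d0 X <= d0 Y) -> cut S A -> full A ->
  exists A', [/\ cut X A', full A' & d0 A' <= d0 A].
Proof.
move=> cons cX mX cA fA.
(* This adds the literals of [X] to [A], then drops their negations. *)
exists (predI (predU A X) (mirror X)); split.
- by move=> c Xc; rewrite /= /mirror negK Xc cons // orbT /= andbF.
- move=> c; rewrite /= /mirror negK fA.
  by case Xc: (X c); case Xn: (X (neg c)); case: (A c) => //=;
    have := cons _ Xc; rewrite Xn.
(* The intersection of [A] and [X], and the union of all three sets, are cuts of [S] and so cost at
   least [d0 X = d0 (mirror X)]; hence neither uncrossing raises the cost. *)
have := outdeg_submod N T0 H0 A X.
have := outdeg_submod N T0 H0 (predU A X) (mirror X).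
have := mX _ (cut_predI cA cX).
have := mX _ (cut_predU (cut_predU cA cX) (cut_mirror cX)).
rewrite skew; lia.
Qed.

Definition stable (S : pred nat) : Prop :=
  consistent S /\ forall Y, cut S Y -> d0 S <= d0 Y.

Lemma least_mincut_stable S X : least_mincut S X -> stable X.
Proof.
move=> mcX; split; first exact: least_mincut_consistent mcX.
move=> Y cY; case: mcX => cX mX; apply: (mX Y _).1.
by move: cY; apply: sub_cut => c /cX /andP[].
Qed.

Definition unsafe (S : pred nat) (l : nat) : Prop :=
  forall X, cut (adjoin S l) X -> d0 S < d0 X.

Definition safe_step (S : pred nat) (l : nat) (S' : pred nat) : Prop :=
  least_mincut (adjoin S l) S' /\ d0 S' <= d0 S.

(** A relation, since a least minimum cut is exhibited only by the search. The last index records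
    whether the bit [b] was consulted. *)
Variant step (S : pred nat) (l : nat) (b : bool) : pred nat -> bool -> Prop :=
  | StepAssigned of S l || S (neg l) : step S l b S false
  | StepSafe S' of ~~ (S l || S (neg l)) & safe_step S l S' :
      step S l b S' false
  | StepSafeNeg S' of ~~ (S l || S (neg l)) & unsafe S l
      & safe_step S (neg l) S' : step S l b S' false
  | StepBranch S' of ~~ (S l || S (neg l)) & unsafe S l & unsafe S (neg l)
      & least_mincut (adjoin S (if b then l else neg l)) S' : step S l b S'
        true.

Fixpoint run (S : pred nat) (ls : seq nat) (g : seq bool) (Sf : pred nat)
    : Prop :=
  match ls with
  | [::] => Sf = S
  | l :: ls' => exists S' u, step S l (head false g) S' u /\
                  run S' ls' (if u then behead g else g) Sf
  end.

Lemma safe_not_unsafe S l S' : safe_step S l S' -> ~ unsafe S l.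
Proof. by move=> [[cS' _] le] us; move: (us _ cS'); rewrite ltnNge le. Qed.

Lemma step_stable S l b S' u : stable S -> step S l b S' u ->
  [/\ stable S', forall c, S c -> S' c & S' l || S' (neg l)].
Proof.
have adj X l' : least_mincut (adjoin S l') X ->
    (l' = l \/ l' = neg l) ->
    [/\ stable X, forall c, S c -> X c & X l || X (neg l)].
  move=> mX el; have cX := mX.1; split; first exact: least_mincut_stable mX.
    by move=> c Sc; have /cX/andP[] : adjoin S l' c by rewrite /adjoin Sc.
  have /cX/andP[] : adjoin S l' l' by rewrite /adjoin eqxx orbT.
  by case: el => -> -> //; rewrite orbT.
move=> stS; case=> //.
- by move=> X _ [mX _]; apply: adj mX _; left.
- by move=> X _ _ [mX _]; apply: adj mX _; right.
- by move=> X _ _ _ mX; apply: adj mX _; case: b; [left | right].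
Qed.

(* Branching strictly raises [d0 S], which is a lower bound on [d0 A];
  so at most
   [n] of the guessed bits are ever consulted. *)
Lemma run_complete ls S A n : stable S -> cut S A -> full A ->
  d0 A <= n + d0 S ->
  exists2 g, size g = n & forall Sf, run S ls g Sf ->
    exists A', [/\ cut Sf A', full A' & d0 A' <= d0 A].
Proof.
elim: ls S A n => [|l ls IH] S A n stS cA fA leA.
  by exists (nseq n false); [rewrite size_nseq | move=> Sf ->; exists A].
case Sl: (S l || S (neg l)).
  have [g sg hg] := IH _ _ _ stS cA fA leA; exists g => // Sf [S' [u []]].
  by case=> //; rewrite ?Sl // => _; apply: hg.
have safe_case l' S' : safe_step S l' S' -> exists2 g, size g = n &
    forall Sf, run S' ls g Sf ->
      exists A', [/\ cut Sf A', full A' & d0 A' <= d0 A].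
  move=> [mS' leS']; have cS' := cut_adjoin mS'.1.
  have stS' := least_mincut_stable mS'.
  have [A' [cA' fA' leA']] : exists A', [/\ cut S' A', full A' & d0 A' <= d0 A].
    apply: (persistency stS'.1 cS' _ cA fA) => Y cY.
    exact: leq_trans leS' (stS.2 _ cY).
  have S_S' := stS.2 _ cS'.
  have [|g sg hg] := IH _ _ n stS' cA' fA'; first by lia.
  exists g => // Sf /hg [B [cB fB leB]]; exists B; split=> //; lia.
(* A safe step excludes the unsafe alternatives and has a unique result, so the run is forced and
   spends no bit. *)
case: (classic (exists S', safe_step S l S')) => [[S' sS']|ns].
  have [g sg hg] := safe_case _ _ sS'; exists g => // Sf [S'' [u []]].
  case; rewrite ?Sl //.
  - by move=> X _ [mX _]; rewrite (least_mincut_unique mX sS'.1); apply: hg.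
  - by move=> X _ /(safe_not_unsafe sS').
  - by move=> X _ /(safe_not_unsafe sS').
case: (classic (exists S', safe_step S (neg l) S')) => [[S' sS']|nsn].
  have [g sg hg] := safe_case _ _ sS'; exists g => // Sf [S'' [u []]].
  case; rewrite ?Sl //.
  - by move=> X _ sX; case: ns; exists X.
  - by move=> X _ _ [mX _]; rewrite (least_mincut_unique mX sS'.1); apply: hg.
  - by move=> X _ _ /(safe_not_unsafe sS').
have onlyb g Sf : run S (l :: ls) g Sf -> exists S',
    [/\ unsafe S l, unsafe S (neg l),
        least_mincut (adjoin S (if head false g then l else neg l)) S'
      & run S' ls (behead g) Sf].
  move=> [S' [u []]]; case; rewrite ?Sl //.
  - by move=> X _ sX; case: ns; exists X.
  - by move=> X _ _ sX; case: nsn; exists X.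
  - by move=> X _ u1 u2 mX rX; exists X.
(* The right bit for a branch on [l] is its value in [A]. *)
pose l' := if A l then l else neg l.
have cAl : cut (adjoin S l') A.
  move=> c; rewrite /adjoin => /orP[/cA //|/eqP->]; rewrite fA negbK andbb.
  by rewrite /l'; case Al: (A l) => //; rewrite fA Al.
have lt_unsafe X : cut (adjoin S l') X -> unsafe S l -> unsafe S (neg l) ->
    d0 S < d0 X.
  by rewrite /l'; case: (A l) => cX u1 u2; [apply: u1 | apply: u2].
(* With no bits left, [d0 A <= d0 S], whereas [A] is a cut of [adjoin S l'], which a branch would
   require to be unsafe; so no run branches here. *)
case: n leA {safe_case} => [|n] leA.
  exists [::] => // Sf /onlyb[X [u1 u2 _ _]].
  by have := lt_unsafe _ cAl u1 u2; lia.
(* If the least minimum cut does not exist or a literal is not unsafe, no run with this first bit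
   exists and the remaining bits are arbitrary. *)
case: (classic (exists2 S', least_mincut (adjoin S l') S' &
                unsafe S l /\ unsafe S (neg l))); last first.
  move=> nex; exists (A l :: nseq n false); first by rewrite /= size_nseq.
  by move=> Sf /onlyb [S' [u1 u2 /= mS' _]]; case: nex; exists S'.
move=> [S' mS' [u1 u2]]; have stS' := least_mincut_stable mS'.
have [A' [cA' fA' leA']] : exists A', [/\ cut S' A', full A' & d0 A' <= d0 A].
  by apply: (persistency stS'.1 mS'.1 _ cAl fA) => Y cY; apply: (mS'.2 _ cY).1.
have [leSA _] := mS'.2 _ cAl.
have ltS := lt_unsafe _ mS'.1 u1 u2.
have [|g sg hg] := IH _ _ n stS' cA' fA'; first by lia.
exists (A l :: g) => [|Sf /onlyb[X [_ _ /= mX rX]]]; first by rewrite /= sg.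
move: rX; rewrite (least_mincut_unique mX mS') => /hg [B [cB fB leB]].
exists B; split=> //; lia.
Qed.
End MinimumCuts.

(** * Implication graphs of 2-CNF formulas *)

Definition code (l : literal) : nat := l.1 + l.1 + l.2.
Definition flip (l : literal) : literal := (l.1, ~~ l.2).

Lemma neg_code l : neg (code l) = code (flip l).
Proof.
case: l => x b; rewrite /neg /code /= oddD oddD addbb /= oddb.
by case: b => /=; rewrite ?addn0 ?addn1.
Qed.

Definition lit1 (c : clause) : literal := nth (0, false) c 0.
Definition lit2 (c : clause) : literal :=
  if size c < 2 then lit1 c else nth (0, false) c 1.

(* Arcs [2 i] and [2 i + 1] are the two contrapositive implications of clause
   [i]; a unit clause counts as its literal repeated, and an empty clause, which
   no assignment can satisfy, contributes harmless loops. *)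
Definition implications (F : cnf) (T H : nat -> nat) : Prop :=
  forall i, i < size F -> let c := nth [::] F i in
    [/\ T (i + i) = code (flip (lit1 c)), T (i + i + 1) = code (flip (lit2 c)),
        H (i + i) = (if nilp c then T (i + i) else code (lit2 c)) &
        H (i + i + 1) = (if nilp c then T (i + i + 1) else code (lit1 c))].

(** For a partial assignment [X], a nonempty clause counts only once both its literals are false; so
    growing [X] can only add violations. *)
Definition violated (F : cnf) (X : pred nat) (i : nat) : bool :=
  let c := nth [::] F i in
  nilp c || X (code (flip (lit1 c))) && X (code (flip (lit2 c))).

Definition nviolated (F : cnf) (X : pred nat) : nat :=
  count (violated F X) (iota 0 (size F)).

Lemma sum_pairs (f : nat -> nat) m :
  \sum_(0 <= e < m + m) f e = \sum_(0 <= i < m) (f (i + i) + f (i + i + 1)).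
Proof.
elim: m => [|m IH]; first by rewrite !big_geq.
by rewrite addSn addnS !big_nat_recr //= IH !addn1 addnA.
Qed.

Section Implications.

Variables (F : cnf) (T H : nat -> nat).
Hypothesis TH : implications F T H.
Local Notation m := (size F).
Local Notation d0 := (outdeg (m + m) T H).

(** [mirror] exchanges the roles of the two contrapositive arcs of each clause. *)
Lemma outdeg_mirror X : d0 (mirror X) = d0 X.
Proof.
rewrite /outdeg !sum_pairs !big_nat; apply: eq_bigr => i /andP[_ lti].
have [-> -> -> ->] := TH lti; rewrite /mirror.
case: ifP => _; first by rewrite !andbN.
have nf l : neg (code (flip l)) = code l by rewrite -neg_code negK.
rewrite !nf !neg_code.
by case: (X _); case: (X _); case: (X _); case: (X _).
Qed.

(** Both arcs of a violated nonempty clause leave [A], and neither arc of a satisfied one does; the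
    loops of empty clauses never leave, whence the correction on the left. *)
Lemma outdeg_violated A : full A ->
  d0 A + 2 * count (fun i => nilp (nth [::] F i)) (iota 0 m) = 2 * nviolated F
    A.
Proof.
move=> fA; rewrite /nviolated -!sum1_count.
rewrite [in LHS]big_mkcond [in RHS]big_mkcond /= !big_distrr /= /outdeg
  sum_pairs /index_iota subn0.
rewrite -big_split big_seq [RHS]big_seq; apply: eq_bigr => i.
rewrite mem_iota add0n => lti /=; have [-> -> -> ->] := TH lti;
  rewrite /violated.
case: ifP => _ /=; first by rewrite !andbN.
have nf l : A (code l) = ~~ A (code (flip l))
  by rewrite -fA neg_code /flip negbK; case: l.
rewrite (nf (lit1 _)) (nf (lit2 _)).
by case: (A _); case: (A _).
Qed.

Lemma nviolated_mono A B : full A -> full B -> d0 A <= d0 B ->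
  nviolated F A <= nviolated F B.
Proof.
move=> /outdeg_violated eA /outdeg_violated eB; move: eA eB.
by move: (d0 A) (d0 B) => a b; lia.
Qed.

End Implications.

Lemma remove_occurrencesE F D : remove_occurrences F D =
  [seq nth [::] F i | i <- iota 0 (size F) & i \notin D].
Proof.
rewrite /remove_occurrences -{2}[F](mkseq_nth [::]) /mkseq -map_mask.
by rewrite filter_mask.
Qed.

Lemma clause_true2 a c : size c <= 2 -> clause_true a c =
  ~~ nilp c && (lit_true a (lit1 c) || lit_true a (lit2 c)).
Proof.
by case: c => [|l1 [|l2 [|]]] //= _; rewrite /clause_true /= ?orbF ?orbb.
Qed.

(** Reading undecided variables as false is harmless, because [S] decides every literal of [F]. *)
Lemma violated_deletion_set F (S : pred nat) k : is_2cnf F -> consistent S ->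
  (forall i, i < size F -> let c := nth [::] F i in
     (S (code (flip (lit1 c))) || S (neg (code (flip (lit1 c))))) &&
     (S (code (flip (lit2 c))) || S (neg (code (flip (lit2 c)))))) ->
  nviolated F S <= k ->
  is_deletion_set F k [seq i <- iota 0 (size F) | violated F S i].
Proof.
move=> F2 cS as_ lek; split.
- by rewrite filter_uniq ?iota_uniq.
- by apply/allP => i; rewrite mem_filter mem_iota => /andP[_].
- by rewrite size_filter.
exists (fun x => S (code (x, true))); apply/allP => c.
rewrite remove_occurrencesE => /mapP[i]; rewrite !mem_filter mem_iota add0n.
case/andP => nv /andP[_ lti] ->; move: nv; rewrite lti andbT.
rewrite /violated; case: (nilp _) / boolP => //= nn nv.
rewrite clause_true2 ?nn /=; last by apply: (all_nthP [::] F2).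
have litS l : S (code l) -> lit_true (fun x => S (code (x, true))) l.
  case: l => x [] Sl; rewrite /lit_true /= ?Sl //.
  by have := cS _ Sl; rewrite neg_code /flip /= => /negPf->.
have nf l : neg (code (flip l)) = code l by rewrite -neg_code negK.
have := as_ _ lti; rewrite /= !nf; case/andP => /orP[s1|/litS -> //].
by case/orP=> [s2|/litS ->]; [move: nv; rewrite s1 s2 | rewrite orbT].
Qed.

(** A deletion set contains every clause violated by an assignment that satisfies the rest. *)
Lemma deletion_set_violated F k D : is_2cnf F -> is_deletion_set F k D ->
  exists2 A, full A & nviolated F A <= k.
Proof.
move=> F2 [uD aD sD [a sat]].
pose A : pred nat := fun c => a c./2 == odd c.
have lA l : A (code l) = lit_true a l.
  case: l => x b; rewrite /A /lit_true /code /= addnn halfD odd_double doubleK.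
  by rewrite oddD odd_double oddb; case: b; rewrite ?addn0.
exists A.
  move=> c; rewrite /A.
  have -> : (neg c)./2 = c./2.
    rewrite /neg; case: ifP => oc; last by rewrite -uphalfE uphalf_half oc.
    by case: c oc => //= c; rewrite uphalf_half => /negPf ->.
  have -> : odd (neg c) = ~~ odd c.
    by rewrite /neg; case oc: (odd c) => /=;
      [case: c oc => //= c /negbTE | rewrite oc].
  by case: (a _); case: (odd c).
apply: leq_trans sD; rewrite /nviolated -size_filter.
apply: uniq_leq_size; first by rewrite filter_uniq ?iota_uniq.
move=> i; rewrite mem_filter mem_iota add0n => /andP[vi lti].
apply/negPn/negP => nD.
have : nth [::] F i \in remove_occurrences F D.
  by rewrite remove_occurrencesE; apply: map_f; rewrite mem_filter nD mem_iota.
move/(allP sat); rewrite clause_true2; last by apply: (all_nthP [::] F2).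
move: vi; rewrite /violated; case: (nilp _) => //=.
have fA l : A (code (flip l)) = ~~ lit_true a l.
  by rewrite lA /lit_true /flip /=; case: (a _); case: (l.2).
by rewrite !fA; case: (lit_true _ _); case: (lit_true _ _).
Qed.

(** * An array language compiled to the machine *)

(* [TL0], [HD0]: tails and heads of the implication arcs;
  [TL], [HD]: the same in
   the residual graph; [MK]: marks of literals; [LV], [LE]: log of the search,
   each literal found with the arc that led to it; [BT]: guessed bits; [NG]:
   negation of literal codes; [IN]: input; [OUT]: violated clauses. *)
Variant arr := TL | HD | MK | LV | LE | BT | NG | TL0 | HD0 | IN | OUT.

Definition acode (a : arr) : nat :=
  match a with
  | TL => 0 | HD => 1 | MK => 2 | LV => 3 | LE => 4 | BT => 5 | NG => 6
  | TL0 => 7 | HD0 => 8 | IN => 9 | OUT => 10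
  end.

Variant var :=
  | vM | vK | vN | vSG | vP | vE | vI | vQ | vL | vNL | vX | vW | vLN | vHIT
  | vY | vZ | vJ | vCNT | vRES | vGO | vC.

Definition vcode (v : var) : nat :=
  match v with
  | vM => 0 | vK => 1 | vN => 2 | vSG => 3 | vP => 4 | vE => 5 | vI => 6
  | vQ => 7 | vL => 8 | vNL => 9 | vX => 10 | vW => 11 | vLN => 12 | vHIT => 13
  | vY => 14 | vZ => 15 | vJ => 16 | vCNT => 17 | vRES => 18 | vGO => 19
  | vC => 20
  end.

Inductive hexp :=
  | Num of nat
  | Var of var
  | Get of arr & hexp
  | Plus of hexp & hexp
  | Minus of hexp & hexp.

Inductive cmd :=
  | Set_ of var & hexp
  | Put of arr & hexp & hexp
  | Then of cmd & cmd
  | Test of hexp & cmd & cmd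
  | Loop of hexp & cmd
  | Pass.

Coercion Num : nat >-> hexp.
Coercion Var : var >-> hexp.

Declare Scope cmd_scope.
Delimit Scope cmd_scope with cmd.
Bind Scope cmd_scope with cmd.
Declare Scope hexp_scope.
Delimit Scope hexp_scope with hexp.
Bind Scope hexp_scope with hexp.
Notation "a .[ i ]" := (Get a i%hexp) : hexp_scope.
Notation "x + y" := (Plus x y) : hexp_scope.
Notation "x - y" := (Minus x y) : hexp_scope.
Notation "v ::= e" := (Set_ v e%hexp) (at level 70) : cmd_scope.
Notation "a @ i ::= e" := (Put a i%hexp e%hexp)
  (at level 70, i at level 49, e at level 69) : cmd_scope.
Notation "c ;; d" := (Then c d) (at level 80, right associativity) : cmd_scope.

Record hst := Hst { hv : var -> nat; ha : arr -> nat -> nat }.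

Definition setv (h : hst) (v : var) (x : nat) : hst :=
  Hst (fun v' => if vcode v' == vcode v then x else hv h v') (ha h).

Definition seta (h : hst) (a : arr) (i x : nat) : hst :=
  Hst (hv h) (fun a' => if acode a' == acode a then upd (ha h a') i x
                        else ha h a').

Fixpoint heval (h : hst) (e : hexp) : nat :=
  match e with
  | Num n => n
  | Var v => hv h v
  | Get a e => ha h a (heval h e)
  | Plus e1 e2 => heval h e1 + heval h e2
  | Minus e1 e2 => heval h e1 - heval h e2
  end.

(** Multiplication by a constant as iterated addition; its cost is independent of the input. *)
Definition scale (n : nat) (e : expr) : expr := iter n (Add e) (Const 0).

(* Register 0 holds the base address; cell [i] of array [a] lies at address
   [base + 11 * i + acode a], and variable [v] in register [(vcode v).+1]. *)
Definition address (a : arr) (e : expr) : expr :=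
  Add (Reg 0) (Add (scale 11 e) (Const (acode a))).

Fixpoint cexp (e : hexp) : expr :=
  match e with
  | Num n => Const n
  | Var v => Reg (vcode v).+1
  | Get a e => Cell (address a (cexp e))
  | Plus e1 e2 => Add (cexp e1) (cexp e2)
  | Minus e1 e2 => Sub (cexp e1) (cexp e2)
  end.

Fixpoint comp (c : cmd) : prog :=
  match c with
  | Set_ v e => Assign (vcode v).+1 (cexp e)
  | Put a i e => Store (address a (cexp i)) (cexp e)
  | Then c d => Seq (comp c) (comp d)
  | Test e c d => If (cexp e) (comp c) (comp d)
  | Loop e c => While (cexp e) (comp c)
  | Pass => Skip
  end.

(** The extra step of an assignment or test is included, so the step counts of [hruns] and of the
    compiled program agree exactly. *)
Definition ecost (e : hexp) : nat := (cost (cexp e)).+1.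
Definition pcost (a : arr) (i e : hexp) : nat :=
  (cost (address a (cexp i)) + cost (cexp e)).+1.

Inductive hruns : cmd -> hst -> nat -> hst -> Prop :=
  | HSet h v e : hruns (Set_ v e) h (ecost e) (setv h v (heval h e))
  | HPut h a i e : hruns (Put a i e) h (pcost a i e)
                     (seta h a (heval h i) (heval h e))
  | HThen h1 h2 h3 c d t u : hruns c h1 t h2 -> hruns d h2 u h3 ->
      hruns (Then c d) h1 (t + u) h3
  | HTestT h h' e c d t : heval h e != 0 -> hruns c h t h' ->
      hruns (Test e c d) h (ecost e + t) h'
  | HTestF h h' e c d t : heval h e = 0 -> hruns d h t h' ->
      hruns (Test e c d) h (ecost e + t) h'
  | HLoopT h1 h2 h3 e c t u : heval h1 e != 0 -> hruns c h1 t h2 ->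
      hruns (Loop e c) h2 u h3 -> hruns (Loop e c) h1 (ecost e + t + u) h3
  | HLoopF h e c : heval h e = 0 -> hruns (Loop e c) h (ecost e) h
  | HPass h : hruns Pass h 1 h.

Definition represents (B : nat) (h : hst) (s : state) : Prop :=
  [/\ reg s 0 = B, forall v, reg s (vcode v).+1 = hv h v &
      forall a i, mem s (B + 11 * i + acode a) = ha h a i].

Lemma acode_lt a : acode a < 11.
Proof. by case: a. Qed.

Lemma eval_scale s n e : eval s (scale n e) = n * eval s e.
Proof. by elim: n => // n IH; rewrite /= -/(scale n e) IH mulSn. Qed.

Lemma eval_address s a e :
  eval s (address a e) = reg s 0 + 11 * eval s e + acode a.
Proof. by rewrite -eval_scale -addnA. Qed.

Lemma eval_cexp B h s e : represents B h s -> eval s (cexp e) = heval h e.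
Proof.
move=> rep; have [rB rv ra] := rep.
elim: e => [//|v|a e IH|e1 IH1 e2 IH2|e1 IH1 e2 IH2]; cbn [cexp heval eval].
- exact: rv.
- by rewrite eval_address rB IH ra.
- by rewrite IH1 IH2.
- by rewrite IH1 IH2.
Qed.

Lemma comp_runs B c h t h' : hruns c h t h' ->
  forall s, represents B h s ->
  exists2 s', runs (comp c) s t s' & represents B h' s'.
Proof.
elim=> {c h t h'}
  [h v e|h a i e|h1 h2 h3 c d t u _ IH1 _ IH2|h h' e c d t ne _ IH
  |h h' e c d t e0 _ IH|h1 h2 h3 e c t u ne _ IH1 _ IH2|h e c e0|h] s rep;
  have [rB rv ra] := rep.
- eexists; first exact: RunAssign.
  split=> //= v'; rewrite /upd eqSS (eval_cexp _ rep).
  by case: ifP.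
- eexists; first exact: RunStore.
  split=> // a' i'; cbn [mem ha seta]; rewrite /upd eval_address rB !(eval_cexp
    _ rep).
  (* Codes are below 11, so an address determines both array and index. *)
  have := acode_lt a; have := acode_lt a'.
  case: (acode a' =P acode a) => [ea|nea] lt1 lt2.
    rewrite ea; case: eqP => [E|nE]; case: eqP => [E'|nE'] //;
      rewrite -?ea ?ra //; lia.
  case: eqP => [E|//]; lia.
- have [s2 r1 rep2] := IH1 s rep; have [s3 r2 rep3] := IH2 s2 rep2.
  by exists s3 => //; apply: RunSeq r1 r2.
- have [s' r rep'] := IH s rep; exists s' => //.
  by rewrite /ecost addSn; apply: RunIfTrue r; rewrite (eval_cexp _ rep).
- have [s' r rep'] := IH s rep; exists s' => //.
  by rewrite /ecost addSn; apply: RunIfFalse r; rewrite (eval_cexp _ rep).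
- have [s2 r1 rep2] := IH1 s rep; have [s3 r2 rep3] := IH2 s2 rep2.
  exists s3 => //; rewrite /ecost !addSn.
  by apply: RunWhileTrue r1 r2; rewrite (eval_cexp _ rep).
- by exists s => //; apply: RunWhileFalse; rewrite (eval_cexp _ rep).
- by exists s => //; apply: RunSkip.
Qed.

(** * Frame conditions for commands *)

Fixpoint vmods (c : cmd) : seq nat :=
  match c with
  | Set_ v _ => [:: vcode v]
  | Put _ _ _ | Pass => [::]
  | Then c d | Test _ c d => vmods c ++ vmods d
  | Loop _ c => vmods c
  end.

Fixpoint amods (c : cmd) : seq nat :=
  match c with
  | Put a _ _ => [:: acode a]
  | Set_ _ _ | Pass => [::]
  | Then c d | Test _ c d => amods c ++ amods d
  | Loop _ c => amods c
  end.

(** Stated on codes, so that membership in the lists of modified items is decided by computation. *)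
Definition framed (c : cmd) (h h' : hst) : Prop :=
  (forall v, vcode v \notin vmods c -> hv h' v = hv h v) /\
  (forall a, acode a \notin amods c -> ha h' a = ha h a).

Lemma framed_refl c h : framed c h h. Proof. by []. Qed.

Lemma framed_trans c h1 h2 h3 :
  framed c h1 h2 -> framed c h2 h3 -> framed c h1 h3.
Proof.
move=> [v12 a12] [v23 a23].
by split=> x nx; [rewrite v23 ?v12 | rewrite a23 ?a12].
Qed.

Lemma framed_sub c d h h' : {subset vmods c <= vmods d} ->
  {subset amods c <= amods d} -> framed c h h' -> framed d h h'.
Proof.
by move=> sv sa [fv fa]; split=> x nx;
  [apply: fv; apply: contra nx => /sv | apply: fa; apply: contra nx => /sa].
Qed.

Lemma hruns_framed c h t h' : hruns c h t h' -> framed c h h'.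
Proof.
elim=> {c h t h'}
  [h v e|h a i e|h1 h2 h3 c d t u _ F1 _ F2|h h' e c d t _ _ F
  |h h' e c d t _ _ F|h1 h2 h3 e c t u _ _ F1 _ F2|h e c _|h] //.
- by split=> v' //=; rewrite inE => /negPf->.
- by split=> a' //=; rewrite inE => /negPf->.
- by apply: (@framed_trans _ _ h2); [move: F1|move: F2];
    apply: framed_sub => x /= xi;
    rewrite mem_cat xi ?orbT.
- by move: F; apply: framed_sub => x /= xi; rewrite mem_cat xi ?orbT.
- by move: F; apply: framed_sub => x /= xi; rewrite mem_cat xi ?orbT.
- exact: framed_trans F1 F2.
Qed.

(** * A weakest-precondition calculus that tracks running time *)

Definition wp (c : cmd) (Q : nat -> hst -> Prop) (h : hst) : Prop :=
  exists t h', hruns c h t h' /\ Q t h'.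

(** Hands the frame condition to the new postcondition, so that invariants mention only what a
    command changes. *)
Lemma wp_weaken c (Q Q' : nat -> hst -> Prop) h :
  wp c Q h -> (forall t h', framed c h h' -> Q t h' -> Q' t h') -> wp c Q' h.
Proof.
move=> [t [h' [r q]]] sub; exists t, h'; split=> //.
exact: sub (hruns_framed r) q.
Qed.

Lemma wp_then c d Q h :
  wp c (fun t h1 => wp d (fun u h2 => Q (t + u) h2) h1) h -> wp (Then c d) Q h.
Proof.
move=> [t [h1 [r1 [u [h2 [r2 q]]]]]]; exists (t + u), h2; split=> //.
exact: HThen r1 r2.
Qed.

Lemma wp_test e c d Q h :
  (heval h e != 0 -> wp c (fun t h' => Q (ecost e + t) h') h) ->
  (heval h e = 0 -> wp d (fun t h' => Q (ecost e + t) h') h) ->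
  wp (Test e c d) Q h.
Proof.
move=> qt qf; case: (eqVneq (heval h e) 0) => [e0|ne].
  have [t [h' [r q]]] := qf e0; exists (ecost e + t), h'; split=> //.
  exact: HTestF r.
have [t [h' [r q]]] := qt ne; exists (ecost e + t), h'; split=> //.
exact: HTestT r.
Qed.

Fixpoint loopfree (c : cmd) : bool :=
  match c with
  | Then c d | Test _ c d => loopfree c && loopfree d
  | Loop _ _ => false
  | _ => true
  end.

Fixpoint exec (c : cmd) (h : hst) : hst :=
  match c with
  | Set_ v e => setv h v (heval h e)
  | Put a i e => seta h a (heval h i) (heval h e)
  | Then c d => exec d (exec c h)
  | Test e c d => if heval h e == 0 then exec d h else exec c h
  | _ => h
  end.

(** Charges both branches of a test, which gives a bound independent of the state. *)
Fixpoint tcost (c : cmd) : nat :=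
  match c with
  | Set_ v e => ecost e
  | Put a i e => pcost a i e
  | Then c d => tcost c + tcost d
  | Test e c d => ecost e + (tcost c + tcost d)
  | _ => 1
  end.

Lemma wp_exec c h : loopfree c ->
  wp c (fun t h' => t <= tcost c /\ h' = exec c h) h.
Proof.
elim: c h => [v e|a i e|c IHc d IHd|e c IHc d IHd|//|] h /=.
- by move=> _; eexists _, _; split; first exact: HSet.
- by move=> _; eexists _, _; split; first exact: HPut.
- case/andP=> lc ld; apply: wp_then.
  have := IHc h lc; move/wp_weaken; apply=> t h1 _ [let1 ->].
  have := IHd (exec c h) ld; move/wp_weaken; apply=> u h2 _ [le2 ->].
  by split=> //; apply: leq_add.
- case/andP=> lc ld; apply: wp_test => [/negPf->|->].
    have := IHc h lc; move/wp_weaken; apply=> t h1 _ [le1 ->]; split=> //; lia.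
  have := IHd h ld; move/wp_weaken; apply=> t h1 _ [le1 ->]; split=> //; lia.
- by move=> _; eexists _, _; split; first exact: HPass.
Qed.

(* [p] is a time budget out of which each iteration pays. *)
Lemma wp_loop (I : nat -> hst -> Prop) e c p h :
  (forall p h', framed c h h' -> I p h' -> heval h' e != 0 ->
     wp c (fun t h'' => exists2 q, ecost e + t + q <= p & I q h'') h') ->
  I p h ->
  wp (Loop e c) (fun t h' => heval h' e = 0 /\
       exists2 q, t + q <= p + ecost e & I q h') h.
Proof.
move=> body Ip; move: (framed_refl c h) Ip.
(* Induction on the budget: each round pays at least [ecost e], which is positive. *)
suff gen n p' h' : p' < n -> framed c h h' -> I p' h' ->
    wp (Loop e c) (fun t h' => heval h' e = 0 /\
       exists2 q, t + q <= p' + ecost e & I q h') h' by apply: gen (ltnSn p).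
elim: n p' h' => // n IH p' h' ltp fr Ih.
case: (eqVneq (heval h' e) 0) => [e0|ne].
  exists (ecost e), h'; split; first exact: HLoopF.
  by split=> //; exists p' => //; lia.
have [t [h2 [r [q leq Iq]]]] := body _ _ fr Ih ne.
have [|u [h3 [r3 [e3 [q' leq' I3]]]]] :=
  IH q h2 _ (framed_trans fr (hruns_framed r)) Iq.
  by move: leq; rewrite /ecost; lia.
exists (ecost e + t + u), h3; split; first exact: HLoopT r r3.
by split=> //; exists q' => //; lia.
Qed.

(** Truncated subtraction makes [b - v] the test [v < b]. *)
Definition For (v : var) (b : hexp) (c : cmd) : cmd :=
  (v ::= 0 ;; Loop (b - v) (c ;; v ::= v + 1))%cmd.

(** [vI] stands for any loop variable, since all registers cost the same to read. *)
Definition fcost (b : hexp) : nat := ecost (b - vI) + ecost (vI + 1) + ecost 0.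

(** A round may spend [k] steps outright and more out of the budget [p], which amortises rounds of
    uneven cost. The invariant is read at the loop head, after [v] has advanced. *)
Lemma wp_for (I : nat -> nat -> hst -> Prop) v b c n k p h :
  I 0 p (setv h v 0) ->
  (forall i p h', i <= n -> framed (For v b c) h h' -> I i p h' ->
     heval h' b = n) ->
  (forall i p h', i < n -> framed (For v b c) h h' -> hv h' v = i ->
     I i p h' ->
     wp c (fun t h'' => hv h'' v = i /\
             exists2 q, t + q <= p + k & I i.+1 q (setv h'' v i.+1)) h') ->
  wp (For v b c) (fun t h' => hv h' v = n /\
       exists2 q, t + q <= p + n * (k + fcost b) + fcost b & I n q h') h.
Proof.
move=> I0 Ib body; apply: wp_then.
eexists _, _; split; first exact: HSet.
rewrite [heval _ _]/=.
(* The budget reserves the allowance of the [n - i] rounds still to come. *)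
pose J p' h' := exists2 i, [/\ i <= n, hv h' v = i & framed (For v b c) h h'] &
                exists2 q, q + (n - i) * (k + fcost b) <= p' & I i q h'.
have := @wp_loop J (b - v)%hexp (c ;; v ::= v + 1)%cmd (p + n * (k + fcost b))
         (setv h v 0); set P := wp _ _ _ => H.
have {H} : P.
  apply: H.
    move=> p' h' _ [i [lei vi fr] [q leq Iq]] /= ne.
    move: ne; rewrite (Ib _ _ _ lei fr Iq) vi => ne.
    have lti : i < n by lia.
    apply: wp_then; have := body _ _ _ lti fr vi Iq.
    move/wp_weaken; apply=> t h2 fr2 [v2 [q' leq' I2]].
    eexists _, _; split; first exact: HSet.
    rewrite [heval _ _]/= v2 addn1.
    exists (q' + (n - i.+1) * (k + fcost b)); last first.
      exists i.+1; last by exists q'.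
      split=> //; first by rewrite /= eqxx.
      apply: (framed_trans fr).
      apply: (@framed_trans _ _ h2).
        by apply: framed_sub fr2 => x /= xi; rewrite ?inE mem_cat xi ?orbT.
      split=> //= v'; rewrite !inE mem_cat inE => /norP[_ /norP[_ ]].
      by move/negPf->.
    have -> : ecost (b - v) = ecost (b - vI) by [].
    have -> : ecost (v + 1) = ecost (vI + 1) by [].
    have e1 : (n - i) * (k + fcost b) =
              (n - i.+1) * (k + fcost b) + (k + fcost b).
      by rewrite -mulSnr; congr (_ * _); lia.
    have : fcost b = ecost (b - vI) + ecost (vI + 1) + ecost 0 by [].
    by move: leq leq'; rewrite e1; lia.
  exists 0; last by exists p => //; rewrite subn0.
  split=> //; first by rewrite /= eqxx.
  by split=> //= v'; rewrite !inE => /norP[/negPf->].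
rewrite /P; move/wp_weaken; apply=> t h' _ [e0 [q leq [i [lei vi fr] [q' leq'
  Iq]]]].
have ein : i = n.
  by move: e0; rewrite /= (Ib _ _ _ lei fr Iq) vi; lia.
move: vi fr leq' Iq; rewrite ein => vi fr leq' Iq.
split=> //; exists q' => //.
have : fcost b = ecost (b - vI) + ecost (vI + 1) + ecost 0 by [].
have : ecost (b - v) = ecost (b - vI) by [].
by move: leq leq'; rewrite subnn; lia.
Qed.

Lemma wp_for_simple (I : nat -> hst -> Prop) v b c n k h :
  I 0 (setv h v 0) ->
  (forall i h', i <= n -> framed (For v b c) h h' -> I i h' ->
     heval h' b = n) ->
  (forall i h', i < n -> framed (For v b c) h h' -> hv h' v = i -> I i h' ->
     wp c (fun t h'' => [/\ hv h'' v = i,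
       t <= k & I i.+1 (setv h'' v i.+1)]) h') ->
  wp (For v b c) (fun t h' => [/\ hv h' v = n,
       t <= n * (k + fcost b) + fcost b & I n h']) h.
Proof.
move=> I0 Ib body.
have := @wp_for (fun i p h => p = 0 /\ I i h) v b c n k 0 h.
set P := wp _ _ _ => H.
have {H} : P.
  apply: H => //; first by move=> i p h' lei fr [_]; apply: Ib.
  move=> i p h' lti fr vi [-> Ii]; have := body _ _ lti fr vi Ii.
  by move/wp_weaken; apply=> t h2 _ [v2 lek I2]; split=> //; exists 0;
    rewrite ?addn0.
by move/wp_weaken; apply=> t h' _ [vn [q leq [q0 In]]]; split=> //; lia.
Qed.

(** * Searching the residual graph *)

(** [MK.[x] - vSG] is nonzero exactly when [x] is marked. [vHIT] is shifted by one, so that 0 means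
    no hit. *)
Definition scan : cmd :=
  Test (MK.[TL.[vE]] - vSG)
    (Test (MK.[HD.[vE]] - vSG) Pass
       (vW ::= HD.[vE] ;;
        MK @ vW ::= vSG + 1 ;;
        LV @ vLN ::= vW ;;
        LE @ vLN ::= vE ;;
        vLN ::= vLN + 1 ;;
        Test (MK.[NG.[vW]] - (vSG + 1)) (vHIT ::= vW + 1) Pass))
    Pass.

(** Entry 0 of the log is the start literal, which counts as part of the source set; found literals
    begin at entry 1. *)
Definition search : cmd :=
  (MK @ vX ::= vSG + 2 ;;
   LV @ 0 ::= vX ;;
   vLN ::= 1 ;;
   vHIT ::= 0) ;;
  For vP (vN + 1) (For vE vN scan).

Definition fill : cmd := For vI vLN (MK @ LV.[vI] ::= vZ).

(** The tail of a logged arc lies in the source set or was logged earlier, so one backward sweep of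
    the log meets the whole path. The sum of two truncated differences tests inequality. *)
Definition trace_step : cmd :=
  vI ::= vLN - 1 - vQ ;;
  Test ((LV.[vI] - vY) + (vY - LV.[vI])) Pass
    (vE ::= LE.[vI] ;;
     vW ::= TL.[vE] ;;
     TL @ vE ::= HD.[vE] ;;
     HD @ vE ::= vW ;;
     vY ::= vW).

Definition trace : cmd :=
  vY ::= vHIT - 1 ;; For vQ (vLN - 1) trace_step.

(* Relative to the stamp [sg], a mark [sg + 2] means membership in [S] and
   [sg + 1] membership in the set found by the current search; entries
   [0 < j < ln] of the log list that set in order of discovery. *)
Record search_inv (N : nat) (T H : nat -> nat) (sg : nat) (S : pred nat)
    (mk lv le : nat -> nat) (ln hit : nat) : Prop := SearchInv {
  si_le : forall c, mk c <= sg + 2;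
  si_S : forall c, S c = (sg + 1 < mk c);
  si_R : forall c, sg < mk c <-> S c \/ exists2 j, 0 < j < ln & lv j = c;
  si_arc : forall j, 0 < j < ln ->
             [/\ le j < N, H (le j) = lv j & ~~ S (lv j)];
  si_tail : forall j, 0 < j < ln ->
             S (T (le j)) \/ exists2 i, 0 < i < j & lv i = T (le j);
  si_inj : forall i j, 0 < i < j -> j < ln -> lv i <> lv j;
  si_miss : hit = 0 -> forall j, 0 < j < ln -> ~~ S (neg (lv j));
  si_hit : hit <> 0 ->
             exists2 j, 0 < j < ln & lv j = hit.-1 /\ S (neg (lv j));
  si_ln : 0 < ln
}.

Definition searched (N : nat) (S : pred nat) (h : hst) : Prop :=
  search_inv N (ha h TL) (ha h HD) (hv h vSG) S
    (ha h MK) (ha h LV) (ha h LE) (hv h vLN) (hv h vHIT).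

Definition marked (h : hst) : pred nat := fun c => hv h vSG < ha h MK c.

(** Negation is looked up in a table, as the machine has no parity test; the table covers the
    endpoints of arcs. *)
Definition neg_table (N : nat) (h : hst) : Prop :=
  forall e, e < N -> ha h NG (ha h TL e) = neg (ha h TL e) /\
                     ha h NG (ha h HD e) = neg (ha h HD e).

Lemma scan_exec N S h e : searched N S h -> neg_table N h -> hv h vE = e ->
  e < N -> let h' := exec scan h in
  searched N S h' /\
  ([/\ hv h' vLN = hv h vLN, ha h' MK = ha h MK &
       marked h (ha h TL e) -> marked h (ha h HD e)] \/
   [/\ hv h' vLN = (hv h vLN).+1, marked h (ha h TL e) &
       ~~ marked h (ha h HD e)]).
Proof.
move=> [mle mS mR marc mtail minj mmiss mhit mln] ng eE ltN /=.
rewrite eE; case: eqP => [T0|Tn].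
  by split=> //; left; split=> //; rewrite /marked; lia.
case: eqP => [H0|Hn]; last by split=> //; left; split=> //; rewrite /marked;
  lia.
set h' := (if _ then _ else _).
have [_ ngH] := ng _ ltN; set w := ha h HD e in H0 ngH *.
have w0 : (hv h vSG < ha h MK w) = false by lia.
have wS : S w = false by rewrite mS; lia.
have wlog j : 0 < j < hv h vLN -> ha h LV j <> w.
  by move=> lj E; move: w0; rewrite -E (mR _).2 //; right; exists j.
have eMK : ha h' MK = upd (ha h MK) w (hv h vSG + 1) by rewrite /h'; case: ifP.
have eLV : ha h' LV = upd (ha h LV) (hv h vLN) w by rewrite /h'; case: ifP.
have eLE : ha h' LE = upd (ha h LE) (hv h vLN) e by rewrite /h'; case: ifP.
have eLN : hv h' vLN = (hv h vLN).+1 by rewrite /h'; case: ifP => _ /=;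
  rewrite addn1.
have eT : ha h' TL = ha h TL by rewrite /h'; case: ifP.
have eH : ha h' HD = ha h HD by rewrite /h'; case: ifP.
have eSG : hv h' vSG = hv h vSG by rewrite /h'; case: ifP.
(* The program reads the mark of [neg w] after marking [w]; the two cells differ. *)
have nw : (neg w == w) = false by exact: neg_neq.
have eHIT : hv h' vHIT = if S (neg w) then w.+1 else hv h vHIT.
  rewrite /h' ngH /upd nw mS /=.
  by case: eqP => E; case: ltnP => E2 //=; rewrite ?addn1 //; lia.
clearbody h'; split; last first.
  by right; split=> //; rewrite /marked; [lia | rewrite w0].
have old j : j < hv h vLN -> (j == hv h vLN) = false by lia.
rewrite /searched eMK eLV eLE eLN eT eH eSG eHIT; constructor=> //.
- by move=> c; rewrite /upd; case: ifP => // _; lia.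
- by move=> c; rewrite /upd; case: eqP => [->|//]; rewrite wS; lia.
- move=> c; rewrite {1}/upd; case: eqP => [->|nc].
    split=> _; last by lia.
    by right; exists (hv h vLN); [lia | rewrite /upd eqxx].
  rewrite mR; split=> -[Sc|[j lj E]]; try by left.
    by right; exists j; [lia | rewrite /upd old //; lia].
  case: (eqVneq j (hv h vLN)) => [ej|nj].
    by case: nc; rewrite -E /upd ej eqxx.
  by right; exists j; [lia | move: E; rewrite /upd (negPf nj)].
- move=> j lj; rewrite /upd; case: eqP => [_|nj]; first by rewrite wS.
  by apply: marc; lia.
- move=> j lj; rewrite {1 3}/upd; case: eqP => [ej|nj].
    have /mR [->|[i li E]] : hv h vSG < ha h MK (ha h TL e) by lia.
      by left.
    by right; exists i; [lia | rewrite /upd old //; lia].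
  have lj0 : 0 < j < hv h vLN by lia.
  have [St|[i li E]] := mtail j lj0; first by left.
  by right; exists i; [lia | rewrite /upd old //; lia].
- move=> i j li lj; rewrite /upd old; last by lia.
  by case: eqP => [_|nj]; [apply: wlog; lia | apply: minj; lia].
- case Sn: (S (neg w)) => // /mmiss hm j lj; rewrite /upd.
  by case: eqP => [_|nj]; [rewrite Sn | apply: hm; lia].
- case Sn: (S (neg w)) => nh; last have [j lj E] := mhit nh.
    by exists (hv h vLN); [lia | rewrite /upd eqxx Sn].
  by exists j; [lia | rewrite /upd old //; lia].
Qed.

(** Entries after the first are distinct literals and heads of their arcs, so these arcs are
    distinct. *)
Lemma log_size N T H sg S mk lv le ln hit :
  search_inv N T H sg S mk lv le ln hit -> ln <= N.+1.
Proof.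
move=> [_ _ _ marc _ minj _ _ mln].
have uq : uniq [seq le j | j <- iota 1 ln.-1].
  rewrite map_inj_in_uniq ?iota_uniq // => i j; rewrite !mem_iota => li lj E.
  have [_ Hi _] : [/\ le i < N, H (le i) = lv i & ~~ S (lv i)] by apply: marc;
    lia.
  have [_ Hj _] : [/\ le j < N, H (le j) = lv j & ~~ S (lv j)] by apply: marc;
    lia.
  have Eij : lv i = lv j by rewrite -Hi -Hj E.
  case: (ltngtP i j) => // l.
    by case: (@minj i j); rewrite ?Eij //; lia.
  by case: (@minj j i); rewrite ?Eij //; lia.
have := uniq_leq_size uq (s2 := iota 0 N).
rewrite size_map !size_iota => h; have : ln.-1 <= N; last by lia.
apply: h => x /mapP[j]; rewrite mem_iota => lj ->; rewrite mem_iota add0n.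
by have [] : [/\ le j < N, H (le j) = lv j & ~~ S (lv j)] by apply: marc; lia.
Qed.

(** Induction along the log: each entry is reached by an arc from [S] or from an earlier entry. *)
Lemma searched_least N T H sg S mk lv le ln hit (Y : pred nat) :
  search_inv N T H sg S mk lv le ln hit ->
  (forall c, S c -> Y c) -> closed N T H Y -> forall c, sg < mk c -> Y c.
Proof.
move=> [_ _ mR marc mtail _ _ _ _] SY cY.
have YL n j : j < n -> 0 < j < ln -> Y (lv j).
  elim: n j => // n IH j ltj lj.
  have [ltN <- _] := marc _ lj; apply: cY => //.
  case: (mtail _ lj) => [/SY //|[i li <-]]; apply: IH; lia.
by move=> c /mR [/SY //|[j lj <-]]; apply: YL lj.
Qed.

(** Between searches a mark is either stale, at most [sg], or equal to [sg + 2]. *)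
Definition clean (sg : nat) (S : pred nat) (mk : nat -> nat) : Prop :=
  forall c, [/\ mk c <= sg + 2, S c = (sg < mk c) & S c = (sg + 1 < mk c)].

Definition csearch : nat :=
  tcost scan + fcost vN + fcost vN + fcost (vN + 1) + fcost (vN + 1)
  + tcost (MK @ vX ::= vSG + 2 ;; LV @ 0 ::= vX ;; vLN ::= 1 ;; vHIT ::= 0).

(** A pass that starts with a set not closed lengthens the log, whose length is bounded by
    [log_size]; hence [N.+1] passes close the set. *)
Lemma search_wp N S h : hv h vN = N -> neg_table N h ->
  clean (hv h vSG) S (ha h MK) ->
  wp search (fun t h' => [/\ t <= csearch * (N.+1 * N.+1),
     searched N (adjoin S (hv h vX)) h',
     closed N (ha h TL) (ha h HD) (marked h') & ha h' LV 0 = hv h vX]) h.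
Proof.
move=> eN ng cl; apply: wp_then; apply: wp_weaken (wp_exec _ _) _ =>
  // t0 h0 fr0 [let0 e0].
set S1 := adjoin _ _.
have I0 : searched N S1 h0.
  rewrite e0 /searched /=; constructor=> //.
  - by move=> c; rewrite /upd; have [? _ _] := cl c; case: ifP => // _; lia.
  - move=> c; rewrite /upd /S1 /adjoin; have [_ _ ->] := cl c.
    by case: eqP => [_|_]; [rewrite orbT; lia | rewrite orbF].
  - move=> c; rewrite /upd /S1 /adjoin; have [_ -> _] := cl c.
    case: eqP => [_|_]; first by split=> [_|_]; [left; rewrite orbT | lia].
    by rewrite orbF; split=> [|[//|[j]]]; [left | lia].
  - by move=> j; lia.
  - by move=> j; lia.
  - by move=> i j; lia.
  - by move=> _ j; lia.
pose J h1 := [/\ searched N S1 h1 & ha h1 LV 0 = hv h vX].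
pose clo h1 := closed N (ha h TL) (ha h HD) (marked h1).
apply: wp_weaken; first apply: (@wp_for_simple (fun p h1 =>
  J h1 /\ (clo h1 \/ p < hv h1 vLN))
  vP (vN + 1)%hexp (For vE vN scan) N.+1
  (N * (tcost scan + fcost vN) + fcost vN) h0); last 1 first.
  move=> t h1 fr [_ let1 [[J1 J2] J3]].
  split=> //.
    move: let0 let1; rewrite /csearch.
    move: (tcost scan) (fcost vN) (fcost (vN + 1)) (tcost _); clear; nia.
  case: J3 => // lt; have := log_size J1; lia.
- by rewrite /J /=; split; [split; [exact: I0 | rewrite e0] | right; case: I0].
- by move=> i h1 _ fr _ /=; rewrite fr.1 // fr0.1 // eN addn1.
move=> p h1 ltp fr1 vp [[J1 J2] J3].
(* Within a pass, either the first [e] arcs changed nothing and are closed, or the log has grown and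
   the set was not closed at the start. *)
pose K e h2 := J h2 /\
  (([/\ hv h2 vLN = hv h1 vLN, ha h2 MK = ha h1 MK & forall e', e' < e ->
     marked h1 (ha h TL e') -> marked h1 (ha h HD e')]) \/
   (hv h1 vLN < hv h2 vLN /\ ~ clo h1)).
apply: wp_weaken; first apply: (@wp_for_simple K vE vN scan N (tcost scan) h1);
  last 1 first.
  move=> t h2 fr [_ let2 [[K1 K2] K3]].
  split=> //; first by rewrite fr.1.
  split; first by split.
  case: K3 => [[E1 E2 K3]|[lt ncl]]; last first.
    by right; case: J3 => //=; lia.
  left=> e ltN; rewrite /marked /= E2 fr.1 //; exact: K3.
- by rewrite /K /J /=; split=> //; left.
- by move=> i h2 _ fr _; rewrite [LHS]fr.1 // fr1.1 // fr0.1.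
move=> e h2 ltN fr2 ve [[K1 K2] K3].
have eT : ha h2 TL = ha h TL by rewrite fr2.2 // fr1.2 // fr0.2.
have eH : ha h2 HD = ha h HD by rewrite fr2.2 // fr1.2 // fr0.2.
have eNG : ha h2 NG = ha h NG by rewrite fr2.2 // fr1.2 // fr0.2.
have ng2 : neg_table N h2 by rewrite /neg_table eT eH eNG.
apply: wp_weaken (wp_exec _ _) _ => // t h3 fr3 [let3 e3].
have [] := scan_exec K1 ng2 ve ltN; rewrite -e3 => I3 alt.
have LV0 : ha h3 LV 0 = ha h2 LV 0.
  rewrite e3 /=; case: eqP => // _; case: eqP => // _.
  by case: ifP => _ /=; rewrite /upd; case: eqP => // E; have := si_ln K1;
    rewrite -E.
split=> //; first by rewrite fr3.1.
have eSG : hv h2 vSG = hv h1 vSG by rewrite fr2.1.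
split; first by split=> //; rewrite /= LV0.
case: alt => [[eLN eMK imp]|[eLN m1 m2]]; last first.
  right; rewrite /= eLN; case: K3 => [[E1 E2 _]|[lt ncl]]; last by split=> //;
    lia.
  split; first by lia.
  move=> cl1; move: (cl1 e ltN); rewrite /marked -E2 -eSG -eT -eH.
  by move=> h4; move: m2; rewrite /marked h4.
case: K3 => [[E1 E2 K3]|[lt ncl]]; last by right; rewrite /= eLN.
left; rewrite /= eLN eMK; split=> // e'; rewrite ltnS leq_eqVlt =>
  /predU1P[->|]; last exact: K3.
by move: imp; rewrite /marked E2 eSG eT eH.
Qed.

Definition logged (lv : nat -> nat) (n c : nat) : bool :=
  has (fun j => lv j == c) (iota 0 n).

Lemma loggedP lv n c : reflect (exists2 j, j < n & lv j = c) (logged lv n c).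
Proof.
apply: (iffP hasP) => [[j]|[j lj E]].
  by rewrite mem_iota => /= lj /eqP E; exists j.
by exists j; [rewrite mem_iota | apply/eqP].
Qed.

Lemma loggedS lv n c : logged lv n.+1 c = logged lv n c || (lv n == c).
Proof. by rewrite /logged -addn1 iotaD has_cat /= orbF. Qed.

Lemma fill_wp h :
  wp fill (fun t h' => t <= hv h vLN * (tcost (MK @ LV.[vI] ::= vZ) + fcost vLN)
                            + fcost vLN /\
    forall c, ha h' MK c = if logged (ha h LV) (hv h vLN) c then hv h vZ
                           else ha h MK c) h.
Proof.
apply: wp_weaken; first apply: (@wp_for_simple (fun i h' => forall c,
  ha h' MK c =
  if logged (ha h LV) i c then hv h vZ else ha h MK c) vI vLN
  (MK @ LV.[vI] ::= vZ) (hv h vLN) (tcost (MK @ LV.[vI] ::= vZ)) h);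
    last 1 first.
  by move=> t h' fr [_ let1 I1].
- by [].
- by move=> i h' _ fr _; apply: fr.1.
move=> i h1 lti fr vi I1; apply: wp_weaken (wp_exec _ _) _ =>
  // t h2 fr2 [let2 e2].
split=> //; first by rewrite fr2.1.
move=> c; rewrite e2 /= /upd vi loggedS fr.2 // fr.1 // eq_sym I1.
by case: eqP => _; rewrite ?orbT ?orbF.
Qed.

Definition clear : cmd := vZ ::= 0 ;; fill.
Definition commit : cmd := vZ ::= vSG + 2 ;; fill.

Definition cfill : nat :=
  tcost (MK @ LV.[vI] ::= vZ) + fcost vLN + fcost vLN
  + ecost 0 + ecost (vSG + 2).

(** Every logged literal lies outside [S], so zeroing the logged marks undoes the search. [T] and
    [H] are free, because [trace] may have altered the arrays after the search. *)
Lemma clear_wp N T H S l h : ~~ S l -> ha h LV 0 = l ->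
  search_inv N T H (hv h vSG) (adjoin S l) (ha h MK) (ha h LV) (ha h LE)
    (hv h vLN) (hv h vHIT) ->
  wp clear (fun t h' => t <= cfill * N.+1 /\ clean (hv h vSG) S (ha h' MK)) h.
Proof.
move=> nSl LV0 inv; apply: wp_then; apply: wp_weaken (wp_exec _ _) _ =>
  // t0 h0 fr0 [let0 e0].
apply: wp_weaken (fill_wp _) _ => t1 h1 _ [let1 mk1]; have lsz := log_size inv.
move: let1; have -> : hv h0 vLN = hv h vLN by rewrite fr0.1.
move=> let1; split.
  move: (let0 : t0 <= ecost 0) let1 lsz; rewrite /cfill.
  by move: (hv h vLN) (fcost vLN) (tcost _) (ecost _) (ecost _); clear; nia.
case: inv => mle mS mR marc _ _ _ _ mln.
move=> c; rewrite mk1 e0 /=; case: loggedP => [[j lj E]|nlog].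
  have Sc : S c = false.
    case: (posnP j) => [j0|j0].
      by rewrite -E j0 LV0 (negPf nSl).
    have [_ _] : [/\ ha h LE j < N, H (ha h LE j) = ha h LV j & ~~ adjoin S l
      (ha h LV j)] by apply: marc; lia.
    by rewrite /adjoin E => /norP[/negPf].
  by rewrite Sc; split; lia.
have lc : (c == l) = false by apply/eqP => E; apply: nlog; exists 0;
  rewrite ?LV0.
have eS : S c = adjoin S l c by rewrite /adjoin lc orbF.
split=> //; rewrite ?eS //.
apply/idP/idP => [Sc|]; first by apply/mR; left.
by case/mR=> // -[j lj E]; case: nlog; exists j => //; lia.
Qed.

Lemma commit_wp N T H S l h : ha h LV 0 = l -> 
  search_inv N T H (hv h vSG) (adjoin S l) (ha h MK) (ha h LV) (ha h LE)
    (hv h vLN) (hv h vHIT) ->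
  wp commit (fun t h' => t <= cfill * N.+1 /\
               clean (hv h vSG) (marked h) (ha h' MK)) h.
Proof.
move=> LV0 inv; apply: wp_then; apply: wp_weaken (wp_exec _ _) _ =>
  // t0 h0 fr0 [let0 e0].
apply: wp_weaken (fill_wp _) _ => t1 h1 _ [let1 mk1]; have lsz := log_size inv.
move: let1; have -> : hv h0 vLN = hv h vLN by rewrite fr0.1.
move=> let1; split.
  move: (let0 : t0 <= ecost (vSG + 2)) let1 lsz; rewrite /cfill.
  by move: (hv h vLN) (fcost vLN) (tcost _) (ecost _) (ecost _); clear; nia.
case: inv => mle mS mR marc _ _ _ _ mln.
move=> c; rewrite mk1 e0 /= /marked; case: loggedP => [[j lj E]|nlog].
  have -> : hv h vSG < ha h MK c.
    apply/mR; case: (posnP j) => [j0|j0].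
      by left; rewrite /adjoin -E j0 LV0 eqxx orbT.
    by right; exists j => //; lia.
  by split; lia.
split=> //; rewrite -mS.
by apply/idP/idP => [/mR[//|[j lj E]]|Sc]; [case: nlog; exists j => //;
  lia | apply/mR; left].
Qed.

Definition ctrace : nat := tcost trace_step + fcost (vLN - 1) + fcost (vLN - 1)
  + ecost (vHIT - 1).

(** One augmentation: reversing a path from [S] to the hit lowers by one the out-degree of every set
    that contains [S] and misses the end of the path. *)
Lemma trace_wp N S h : searched N S h -> neg_table N h -> hv h vHIT <> 0 ->
  wp trace (fun t h' => [/\ t <= ctrace * N.+1,
    neg_table N h' & forall X : pred nat,
    (forall c, S c -> X c) -> ~~ X (hv h vHIT).-1 ->
    (outdeg N (ha h' TL) (ha h' HD) X).+1 = outdeg N (ha h TL) (ha h HD) X]) h.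
Proof.
move=> inv ng nhit; have lsz := log_size inv.
case: inv => _ _ _ marc mtail minj _ /(_ nhit)[jw ljw [Ew _]] mln.
apply: wp_then; apply: wp_weaken (wp_exec _ _) _ => // t0 h0 fr0 [let0 e0].
set w := (hv h vHIT).-1 in Ew *; set ln := hv h vLN in marc mtail minj mln ljw
  lsz.
set lv := ha h LV in marc mtail minj Ew; set le := ha h LE in marc mtail.
set T := ha h TL in mtail *; set H := ha h HD in marc *.
(* The path from [vY] to the hit is already reversed; its remainder lies among the entries below
   [ln - q], whose arcs are untouched. *)
pose I q h1 := [/\ neg_table N h1,
  forall X : pred nat, outdeg N (ha h1 TL) (ha h1 HD) X + X (hv h1 vY)
            = outdeg N T H X + X w,
  S (hv h1 vY) \/ (exists2 j, 0 < j < ln - q & lv j = hv h1 vY) &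
  forall j, 0 < j < ln - q -> ha h1 TL (le j) = T (le j) /\ ha h1 HD (le j) = H
    (le j)].
apply: wp_weaken; first apply: (@wp_for_simple I vQ (vLN - 1)%hexp trace_step
  ln.-1
  (tcost trace_step) h0); last 1 first.
- move=> t h1 fr [_ let1 [ng1 I1 I2 _]]; split=> //.
    move: (let0 : t0 <= ecost (vHIT - 1)) let1 lsz; rewrite /ctrace.
    by move: ln {marc mtail minj mln ljw I I2} (fcost _) (tcost _) (ecost _);
      clear; nia.
  move=> X SX nXw; move: (I1 X); rewrite (negPf nXw).
  case: I2 => [/SX -> |[j]]; lia.
- rewrite e0 /I /=; have -> : hv h vHIT - 1 = w by rewrite /w; lia.
  by split=> //; right; exists jw => //; lia.
- by move=> i h1 _ fr _ /=; rewrite fr.1 // fr0.1 // subn1.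
move=> q h1 ltq fr1 vq [ng1 I1 I2 I3].
apply: wp_weaken (wp_exec _ _) _ => // t h2 fr2 [let2 e2].
have eLN : hv h1 vLN = ln by rewrite fr1.1 // fr0.1.
have eLV : ha h1 LV = lv by rewrite fr1.2 // fr0.2.
have eLE : ha h1 LE = le by rewrite fr1.2 // fr0.2.
split=> //; first by rewrite fr2.1.
rewrite e2 /= eLN vq eLV eLE.
set i := ln - 1 - q; have li : 0 < i < ln - q by lia.
have lin : 0 < i < ln by lia.
have [ltE HE _] := marc _ lin.
have [TE' HE'] := I3 _ li.
case: eqP => [E|nE]; last first.
  split=> //=.
    case: I2 => [|[j lj Ej]]; [by left | right; exists j => //].
    case: (eqVneq j i) => [ji|]; last by lia.
    by case: nE; rewrite -Ej ji; lia.
  by move=> j lj; apply: I3; lia.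
have {}E : lv i = hv h1 vY by lia.
rewrite /I /=; set E' := le i in ltE HE TE' HE' *.
split.
- move=> e ltN /=; rewrite /upd; case: ifP => [_|_]; last exact: ng1.
  by have [] := ng1 _ ltE.
- move=> X; rewrite TE' HE' HE E.
  have := @outdeg_reverse N (ha h1 TL) (ha h1 HD) X E' (T E') (hv h1 vY) ltE
    TE'.
  by rewrite HE' HE E => /(_ erefl) ->; apply: I1.
- rewrite TE'; case: (mtail _ lin) => [|[j lj Ej]]; [by left | right].
  by exists j => //; lia.
- move=> j lj; have lj' : 0 < j < ln by lia.
  have [_ Hj _] := marc _ lj'.
  have nj : (le j == E') = false.
    apply/eqP => Ej; have lji : 0 < j < i by lia.
    by case: (minj j i) => //; [lia | rewrite -Hj Ej HE].
  by rewrite /upd nj; apply: I3; lia.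
Qed.

(** * Assigning one literal *)

Definition augment : cmd := Loop vHIT (trace ;; clear ;; search).

Definition choose : cmd :=
  Test BT.[vJ] (vX ::= vL) (vX ::= vNL) ;; vJ ::= vJ + 1.

Definition branch : cmd := choose ;; search ;; augment ;; commit.

Definition process : cmd :=
  vX ::= vL ;; search ;;
  Test vHIT
    (clear ;; vX ::= vNL ;; search ;; Test vHIT (clear ;; branch) commit)
    commit.

Section Process.

Variables (N : nat) (T0 H0 : nat -> nat).
Local Notation d0 := (outdeg N T0 H0).
Hypothesis skew : forall X, d0 (mirror X) = d0 X.

(* The arrays [TL], [HD] hold the residual graph of a flow of value [v] from [S]
   to the negations of [S]: the original arcs,
     with those carrying flow reversed. *)
Definition flow (S : pred nat) (v : nat) (h : hst) : Prop :=
  forall X, cut S X -> outdeg N (ha h TL) (ha h HD) X + v = d0 X.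

Lemma flow_le S v h : consistent S -> flow S v h -> v <= N.
Proof.
move=> cS /(_ S (cut_self cS)) E.
by apply: leq_trans (outdeg_le N T0 H0 S); rewrite -E leq_addl.
Qed.

(** No residual arc leaves [S], so [S] is a minimum cut and its value is that of the flow. *)
Record settled (S : pred nat) (v : nat) (h : hst) : Prop := Settled {
  st_N : hv h vN = N;
  st_neg : neg_table N h;
  st_clean : clean (hv h vSG) S (ha h MK);
  st_flow : flow S v h;
  st_closed : closed N (ha h TL) (ha h HD) S;
  st_cons : consistent S
}.

Section FixedSet.

Variables (S : pred nat) (l : nat).
Hypotheses (cS : consistent S) (nSl : ~~ S l) (nSnl : ~~ S (neg l)).

Record ready (v : nat) (h : hst) : Prop := Ready {
  rd_N : hv h vN = N;
  rd_neg : neg_table N h;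
  rd_clean : clean (hv h vSG) S (ha h MK);
  rd_flow : flow (adjoin S l) v h;
  rd_X : hv h vX = l
}.

Record found (v : nat) (h : hst) : Prop := Found {
  fd_N : hv h vN = N;
  fd_neg : neg_table N h;
  fd_searched : searched N (adjoin S l) h;
  fd_closed : closed N (ha h TL) (ha h HD) (marked h);
  fd_flow : flow (adjoin S l) v h;
  fd_X : hv h vX = l;
  fd_LV : ha h LV 0 = l
}.

(** Max-flow min-cut: no residual arc leaves the marked set, so its value is [v]; any other cut of
    value [v] is closed in the residual graph and hence contains it. *)
Lemma found_miss v h : found v h -> hv h vHIT = 0 ->
  least_mincut N T0 H0 (adjoin S l) (marked h) /\ d0 (marked h) = v.
Proof.
move=> fd miss; have cA := consistent_adjoin cS nSnl.
have inv := fd_searched fd.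
have cm : cut (adjoin S l) (marked h).
  move=> c Ac; apply/andP; split; first by apply/(si_R inv); left.
  apply/negP => /(si_R inv)[An|[j lj E]]; first by move: (cA _ Ac); rewrite An.
  by have := si_miss inv miss lj; rewrite E negK Ac.
have dm : d0 (marked h) = v.
  by rewrite -(fd_flow fd cm) ((outdeg_eq0 _ _ _ _).2 (fd_closed fd)).
split=> //; split=> // Y cY; rewrite dm -(fd_flow fd cY); split;
  first by rewrite leq_addl.
move=> leY; apply: (searched_least inv); first by move=> c /cY /andP[].
by apply/outdeg_eq0; lia.
Qed.

(** A cut of value [v] would be closed in the residual graph and so contain the hit, whose negation
    belongs to the source set. *)
Lemma found_hit v h : found v h -> hv h vHIT <> 0 ->
  forall X, cut (adjoin S l) X -> v < d0 X.
Proof.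
move=> fd nhit X cX; have inv := fd_searched fd.
rewrite -(fd_flow fd cX) -[ltnLHS]add0n ltn_add2r lt0n;
  apply/negP => /eqP/outdeg_eq0 clX.
have [j lj [_ An]] := si_hit inv nhit.
have /andP[_] := cX _ An; rewrite negK => /negP; apply.
by apply: (searched_least inv _ clX); [move=> c /cX/andP[] | apply/(si_R inv);
  right; exists j].
Qed.

Lemma search_ready v h : ready v h ->
  wp search (fun t h' => t <= csearch * (N.+1 * N.+1) /\ found v h') h.
Proof.
move=> [rN rng rcl rfl rX]; apply: wp_weaken (search_wp rN rng rcl) _.
move=> t h' fr [lt inv cl LV0]; rewrite rX in inv LV0.
split=> //; split.
- by rewrite fr.1.
- by rewrite /neg_table !fr.2.
- by [].
- by rewrite !fr.2.
- by rewrite /flow !fr.2.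
- by rewrite fr.1.
- by [].
Qed.

Lemma clear_found v h : found v h ->
  wp clear (fun t h' => t <= cfill * N.+1 /\ ready v h') h.
Proof.
move=> [fN fng finv _ ffl fX fLV].
apply: wp_weaken (clear_wp nSl fLV finv) _ => t h' fr [lt cl]; split=> //;
  split.
- by rewrite fr.1.
- by rewrite /neg_table !fr.2.
- by rewrite fr.1.
- by rewrite /flow !fr.2.
- by rewrite fr.1.
Qed.

Definition caugment : nat := ecost vHIT + ctrace + cfill + csearch.

(** Each round raises [v] by one, and [v] never exceeds [N]; the time is charged to the increase of
    [v]. *)
Lemma augment_found v h : found v h ->
  wp augment (fun t h' => hv h' vHIT = 0 /\ exists2 v', v <= v' &
     t <= caugment * (N.+1 * N.+1) * (v' - v) + ecost vHIT /\ found v' h') h.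
Proof.
move=> fd; have cA := consistent_adjoin cS nSnl.
set c := caugment * (N.+1 * N.+1).
pose I p h1 := exists2 v', v <= v' & p = c * (N - v') /\ found v' h1.
apply: wp_weaken; first apply: (@wp_loop I vHIT (trace ;; clear ;;
  search) (c * (N - v)) h).
- move=> p h1 _ [v' lev [-> fd1]] /eqP nhit.
  have ltv : v' < N.
    by apply: leq_trans (outdeg_le N T0 H0 (adjoin S l));
      apply: (found_hit fd1) => //; apply: cut_self.
  apply: wp_then; apply: wp_weaken (trace_wp (fd_searched fd1) (fd_neg fd1)
    nhit) _.
  move=> t1 h2 fr1 [lt1 ng2 aug]; apply: wp_then.
  have inv1 := fd_searched fd1.
  have rd t h3 : framed clear h2 h3 -> t <= cfill * N.+1 /\ clean (hv h2 vSG) S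
    (ha h3 MK) ->
      ready v'.+1 h3.
    move=> fr2 [_ cl]; split.
    - by rewrite fr2.1 // fr1.1 //; apply: fd_N fd1.
    - by rewrite /neg_table !fr2.2.
    - by rewrite fr2.1.
    - move=> X cX; rewrite !fr2.2 // -(fd_flow fd1 cX) -aug;
        first by rewrite addSnnS.
        by move=> c' /cX/andP[].
      have [j lj [<- An]] := si_hit inv1 nhit.
      by have /andP[_] := cX _ An; rewrite negK.
    - by rewrite fr2.1 // fr1.1 //; apply: fd_X fd1.
  have inv2 : search_inv N (ha h1 TL) (ha h1 HD) (hv h2 vSG) (adjoin S l)
     (ha h2 MK) (ha h2 LV) (ha h2 LE) (hv h2 vLN) (hv h2 vHIT).
    by rewrite !(fr1.1, fr1.2).
  have LV2 : ha h2 LV 0 = l by rewrite fr1.2 //; apply: fd_LV fd1.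
  apply: wp_weaken (clear_wp nSl LV2 inv2) _ => t2 h3 fr2 q2.
  apply: wp_weaken (search_ready (rd _ _ fr2 q2)) _ => t3 h4 fr3 [lt3 fd4].
  exists (c * (N - v'.+1)); last by exists v'.+1 => //; lia.
  have -> : N - v' = (N - v'.+1).+1 by lia.
  have lt2 := q2.1; move: lt1 lt2 lt3; rewrite mulnS /c /caugment.
  move: (N - v'.+1) (ecost vHIT) ctrace cfill csearch; clear; nia.
- by exists v.
move=> t h1 fr [/= hit0 [q leq [v' lev [eq fd1]]]]; split=> //;
  exists v' => //; split=> //.
have := flow_le cA (fd_flow fd1); move: leq; rewrite eq => leq lev'.
have : c * (N - v) = c * (N - v') + c * (v' - v) by rewrite -mulnDr;
  congr (_ * _); lia.
lia.
Qed.

Lemma commit_found v h : found v h -> hv h vHIT = 0 ->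
  wp commit (fun t h' => t <= cfill * N.+1 /\ exists S',
    [/\ settled S' v h', least_mincut N T0 H0 (adjoin S l) S' & d0 S' = v]) h.
Proof.
move=> fd miss; apply: wp_weaken (commit_wp (fd_LV fd) (fd_searched fd)) _.
move=> t h' fr [lt cl]; split=> //; have [mc dm] := found_miss fd miss.
exists (marked h); split=> //; have [fN fng finv fcl ffl fX fLV] := fd.
have sub c : adjoin S l c -> marked h c by move/(mc.1)/andP => [].
split.
- by rewrite fr.1.
- by rewrite /neg_table !fr.2.
- by rewrite fr.1.
(* A cut of the larger set is a cut of [adjoin S l], so the flow carries over. *)
- by move=> X cX; rewrite !fr.2 //; apply: ffl; apply: sub_cut cX.
- by rewrite !fr.2.
- exact: (least_mincut_consistent skew mc).
Qed.

End FixedSet.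
Definition cprocess : nat :=
  caugment + 3 * csearch + 3 * cfill + ecost vL + ecost vNL + tcost choose
  + 3 * ecost vHIT.

Lemma settled_ready S l v h h' : settled S v h ->
  (forall v', vcode v' != vcode vX -> vcode v' != vcode vJ -> hv h' v' = hv h
    v') ->
  ha h' = ha h -> hv h' vX = l -> ready S l v h'.
Proof.
move=> [sN sng scl sfl _ _] fr ea eX; split=> //; rewrite ?fr //.
- by rewrite /neg_table ea.
- by rewrite ea.
- by move=> X cX; rewrite ea; apply: sfl; apply: cut_adjoin cX.
Qed.

Lemma settled_value S v h : settled S v h -> d0 S = v.
Proof.
move=> st; rewrite -(st_flow st (cut_self (st_cons st))).
by rewrite ((outdeg_eq0 _ _ _ _).2 (st_closed st)).
Qed.

Lemma ready_start S l l' v h h' : ready S l v h -> flow (adjoin S l') v h ->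
  (forall v', vcode v' != vcode vX -> vcode v' != vcode vJ -> hv h' v' = hv h
    v') ->
  ha h' = ha h -> hv h' vX = l' -> ready S l' v h'.
Proof.
move=> [sN sng scl _ _] sfl fr ea eX; split=> //; rewrite ?fr //.
- by rewrite /neg_table ea.
- by rewrite ea.
- by rewrite /flow ea.
Qed.

(** A miss yields the least minimum cut of a safe step, a hit yields [unsafe] because [v = d0 S].
    The cost is a bounded number of searches plus one per unit gained by [v]. *)
Lemma process_wp S l v h : settled S v h -> hv h vL = l -> hv h vNL = neg l ->
  ~~ S l -> ~~ S (neg l) ->
  wp process (fun t h' => exists S' v' (u : bool),
    [/\ step N T0 H0 S l (ha h BT (hv h vJ) != 0) S' u, settled S' v' h',
      v <= v',
        hv h' vJ = hv h vJ + u &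
        t <= cprocess * (N.+1 * N.+1) * (v' - v).+1]) h.
Proof.
move=> st eL eNL nSl nSnl; have cS := st_cons st; have dS := settled_value st.
have unas : ~~ (S l || S (neg l)) by rewrite negb_or nSl.
have nSnnl : ~~ S (neg (neg l)) by rewrite negK.
have flA l' : flow (adjoin S l') v h.
  by move=> X /cut_adjoin; apply: st_flow.
apply: wp_then; apply: wp_weaken (wp_exec _ _) _ => // t0 h0 fr0 [lt0 e0].
have rd0 : ready S l v h0.
  by apply: (settled_ready st) => [v' nX _| |]; rewrite e0 //= ifN.
apply: wp_then; apply: wp_weaken (search_ready rd0) _ => t1 h1 fr1 [lt1 fd1].
apply: wp_test; last first.
  move=> /= miss; apply: wp_weaken (commit_found cS nSl nSnl fd1 miss) _.
  move=> t2 h2 fr2 [lt2 [S' [st' mc dS']]]; exists S', v, false; split=> //.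
  - by apply: StepSafe => //; split=> //; rewrite dS dS'.
  - by rewrite fr2.1 // fr1.1 // fr0.1 // addn0.
  move: (lt0 : t0 <= ecost vL) lt1 lt2; rewrite subnn /cprocess.
  by move: caugment csearch cfill (ecost _) (ecost _) (ecost _) (tcost _);
    clear; nia.
move=> /eqP hit1; have us1 : unsafe N T0 H0 S l.
  by move=> X cX; rewrite dS; apply: found_hit fd1 hit1 _ cX.
apply: wp_then; apply: wp_weaken (clear_found nSl fd1) _ => t2 h2 fr2 [lt2 rd2].
apply: wp_then; apply: wp_weaken (wp_exec _ _) _ => // t3 h3 fr3 [lt3 e3].
have fl2 l' : flow (adjoin S l') v h2.
  by rewrite /flow fr2.2 // fr1.2 // fr0.2 // fr2.2 // fr1.2 // fr0.2 //;
    apply: flA.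
have rd3 : ready S (neg l) v h3.
  apply: (ready_start rd2 (fl2 _)) => [v' nX _| |]; rewrite e3 //= ?ifN //.
  by rewrite fr2.1 // fr1.1 // fr0.1.
apply: wp_then; apply: wp_weaken (search_ready rd3) _ => t4 h4 fr4 [lt4 fd4].
apply: wp_test; last first.
  move=> /= miss; apply: wp_weaken (commit_found cS nSnl nSnnl fd4 miss) _.
  move=> t5 h5 fr5 [lt5 [S' [st' mc dS']]]; exists S', v, false; split=> //.
  - by apply: StepSafeNeg => //; split=> //; rewrite dS dS'.
  - by rewrite fr5.1 // fr4.1 // fr3.1 // fr2.1 // fr1.1 // fr0.1 // addn0.
  move: (lt0 : t0 <= ecost vL) lt1 lt2 (lt3 : t3 <= ecost vNL) lt4 lt5.
  rewrite subnn /cprocess.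
  by move: caugment csearch cfill (ecost _) (ecost _) (ecost _) (tcost _);
    clear; nia.
move=> /eqP hit4; have us2 : unsafe N T0 H0 S (neg l).
  by move=> X cX; rewrite dS; apply: found_hit fd4 hit4 _ cX.
apply: wp_then; apply: wp_weaken (clear_found nSnl fd4) _ =>
  t5 h5 fr5 [lt5 rd5].
have fl5 l' : flow (adjoin S l') v h5.
  by rewrite /flow fr5.2 // fr4.2 // fr3.2 // fr5.2 // fr4.2 // fr3.2 //;
    apply: fl2.
apply: wp_then; apply: wp_weaken (wp_exec _ _) _ => // t6 h6 fr6 [lt6 e6].
set b := _ != 0; pose l' := if b then l else neg l.
have eBT : ha h5 BT = ha h BT.
  by rewrite fr5.2 // fr4.2 // fr3.2 // fr2.2 // fr1.2 // fr0.2.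
have eJ : hv h5 vJ = hv h vJ.
  by rewrite fr5.1 // fr4.1 // fr3.1 // fr2.1 // fr1.1 // fr0.1.
have eL5 : hv h5 vL = l.
  by rewrite fr5.1 // fr4.1 // fr3.1 // fr2.1 // fr1.1 // fr0.1.
have eNL5 : hv h5 vNL = neg l.
  by rewrite fr5.1 // fr4.1 // fr3.1 // fr2.1 // fr1.1 // fr0.1.
have rd6 : ready S l' v h6.
  apply: (ready_start rd5 (fl5 _)) => [v' nX nJ| |]; rewrite e6 /=.
  - by rewrite (negPf nJ); case: ifP => _ /=; rewrite (negPf nX).
  - by case: ifP.
  - by rewrite eBT eJ /l' /b; case: eqP => _ /=.
have eJ6 : hv h6 vJ = (hv h vJ).+1.
  by rewrite e6 /=; case: ifP => _ /=; rewrite eJ addn1.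
have nSl' : ~~ S l' by rewrite /l'; case: (b).
have nSnl' : ~~ S (neg l') by rewrite /l'; case: (b); rewrite ?negK.
apply: wp_then; apply: wp_weaken (search_ready rd6) _ => t7 h7 fr7 [lt7 fd7].
apply: wp_then; apply: wp_weaken (augment_found cS nSl' nSnl' fd7) _.
move=> t8 h8 fr8 [miss [v' lev [lt8 fd8]]].
apply: wp_weaken (commit_found cS nSl' nSnl' fd8 miss) _.
move=> t9 h9 fr9 [lt9 [S' [st' mc dS']]]; exists S', v', true; split=> //.
- exact: StepBranch.
- by rewrite fr9.1 // fr8.1 // fr7.1 // eJ6 addn1.
move: (lt0 : t0 <= ecost vL) lt1 lt2 (lt3 : t3 <= ecost vNL) lt4 lt5 lt6 lt7
  lt8 lt9.
rewrite /cprocess mulnS.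
move: (v' - v) caugment csearch cfill (ecost _) (ecost _) (ecost _) (tcost _).
clear; nia.
Qed.

End Process.

(** * One run for a given guess *)

(** The tails of the arcs are the negated literals of the clauses, so running through them decides
    every variable of [F]. *)
Definition pick : cmd := vL ::= TL0.[vC] ;; vNL ::= NG.[vL].

Definition assign_literal : cmd :=
  pick ;;
  Test (MK.[vL] - (vSG + 1)) Pass
    (Test (MK.[vNL] - (vSG + 1)) Pass process).

Definition reset_arc : cmd := TL @ vE ::= TL0.[vE] ;; HD @ vE ::= HD0.[vE].

Definition guess_run : cmd :=
  For vE vN reset_arc ;; vJ ::= 0 ;; For vC vN assign_literal.

Section Run.

Variables (N : nat) (T0 H0 : nat -> nat).
Local Notation d0 := (outdeg N T0 H0).
Hypothesis skew : forall X, d0 (mirror X) = d0 X.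

Definition neg_table0 (h : hst) : Prop :=
  forall e, e < N -> ha h NG (T0 e) = neg (T0 e) /\ ha h NG (H0 e) = neg (H0 e).

Definition casgn : nat := tcost pick + ecost (MK.[vL] - (vSG + 1))
  + ecost (MK.[vNL] - (vSG + 1)) + 1.

Lemma assign_literal_wp S v h l :
  settled N T0 H0 S v h -> ha h TL0 (hv h vC) = l -> ha h NG l = neg l ->
  wp assign_literal (fun t h' => exists S' v' (u : bool),
    [/\ step N T0 H0 S l (ha h BT (hv h vJ) != 0) S' u,
        settled N T0 H0 S' v' h', v <= v', hv h' vJ = hv h vJ + u &
        t <= casgn + cprocess * (N.+1 * N.+1) * (v' - v).+1]) h.
Proof.
move=> st el eng; apply: wp_then; apply: wp_weaken (wp_exec _ _) _ =>
  // t0 h0 fr0 [lt0 e0].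
have eL : hv h0 vL = l by rewrite e0 /= el.
have eNL : hv h0 vNL = neg l by rewrite e0 /= el.
have st0 : settled N T0 H0 S v h0.
  case: st => sN sng scl sfl scd scs; split=> //.
  - by rewrite fr0.1.
  - by rewrite /neg_table !fr0.2.
  - by rewrite fr0.1 // fr0.2.
  - by rewrite /flow !fr0.2.
  - by rewrite !fr0.2.
have eS c : S c = (hv h0 vSG + 1 < ha h0 MK c) by have [_ _] := st_clean st0 c.
have skip : S l || S (neg l) -> exists S' v' (u : bool),
    [/\ step N T0 H0 S l (ha h BT (hv h vJ) != 0) S' u,
        settled N T0 H0 S' v' h0, v <= v' & hv h0 vJ = hv h vJ + u /\ v' = v].
  move=> as_; exists S, v, false; split=> //; first exact: StepAssigned.
  by rewrite fr0.1 // addn0.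
apply: wp_test => /= [ne|e1].
  have [|S' [v' [u [s1 s2 s3 [s4 s5]]]]] := skip; first by rewrite !eS;
    move: ne; rewrite eL; lia.
  apply: wp_weaken (wp_exec _ _) _ => // t1 h1 _ [lt1 ->] /=.
  exists S', v', u; split=> //; move: lt0 lt1; rewrite /casgn [tcost Pass]/=;
    lia.
apply: wp_test => /= [ne|e2].
  have [|S' [v' [u [s1 s2 s3 [s4 s5]]]]] := skip; first by rewrite !eS;
    move: ne; rewrite eNL; lia.
  apply: wp_weaken (wp_exec _ _) _ => // t1 h1 _ [lt1 ->] /=.
  exists S', v', u; split=> //; move: lt0 lt1; rewrite /casgn [tcost Pass]/=;
    lia.
have nSl : ~~ S l by rewrite eS -eL; lia.
have nSnl : ~~ S (neg l) by rewrite eS -eNL; lia.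
apply: wp_weaken (process_wp skew st0 eL eNL nSl nSnl) _.
move=> t1 h1 fr1 [S' [v' [u [s1 s2 s3 s4 s5]]]]; exists S', v', u; split=> //.
- by move: s1; rewrite fr0.2 // fr0.1.
- by rewrite s4 fr0.1.
move: lt0 s5; rewrite /casgn; lia.
Qed.

Definition crun : nat := 2 * cprocess + casgn + 2 * fcost vN + 2 * fcost vN
  + tcost reset_arc + ecost 0.

Lemma run0_stable : stable N T0 H0 pred0.
Proof.
split=> // Y _; have -> // : outdeg N T0 H0 pred0 = 0.
by apply/outdeg_eq0.
Qed.

(** The gains of [v] over all literals add up to at most [N], which keeps the number of searches
    linear. Marks of at most [vSG] represent the empty set. *)
Lemma guess_run_wp h g : hv h vN = N -> ha h TL0 = T0 -> ha h HD0 = H0 ->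
  neg_table0 h -> (forall c, ha h MK c <= hv h vSG) ->
  (forall i, ha h BT i = nth false g i) ->
  wp guess_run (fun t h' => t <= crun * (N.+1 * N.+1 * N.+1) /\ exists Sf,
    [/\ run N T0 H0 pred0 [seq T0 e | e <- iota 0 N] g Sf, consistent Sf,
        forall e, e < N -> Sf (T0 e) || Sf (neg (T0 e)) &
        clean (hv h vSG) Sf (ha h' MK)]) h.
Proof.
move=> eN eT eH ng mk bt; apply: wp_then.
apply: wp_weaken; first apply: (@wp_for_simple (fun i h1 => forall e, e < i ->
   ha h1 TL e = T0 e /\ ha h1 HD e = H0 e) vE vN reset_arc N (tcost reset_arc)
     h); last 1 first.
- move=> t0 h0 fr0 [_ lt0 I0]; apply: wp_then.
  apply: wp_weaken (wp_exec _ _) _ => // t1 h1 fr1 [lt1 e1].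
  have sum0 X : outdeg N (ha h1 TL) (ha h1 HD) X = d0 X.
    rewrite e1 /outdeg /= !big_nat; apply: eq_bigr => e /andP[_ lte].
    by have [-> ->] := I0 _ lte.
  have st1 : settled N T0 H0 pred0 0 h1.
    split=> //.
    - by rewrite fr1.1 // fr0.1.
    - move=> e lte; rewrite e1 /=; have [-> ->] := I0 _ lte.
      by rewrite fr0.2 //; apply: ng.
    - move=> c; rewrite fr1.2 // fr1.1 // fr0.2 // fr0.1 //.
      by have := mk c; rewrite /=; split; lia.
    - by move=> X _; rewrite sum0 addn0.
  have fr01 a : acode a \notin [:: acode TL; acode HD] -> ha h1 a = ha h a.
    by move=> na; rewrite e1 /= fr0.2.
  set c := cprocess * (N.+1 * N.+1).
  (* [drop J g] holds the bits not yet used; the last clause extends a run on the remaining literals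
     to one from the empty set. *)
  pose I i p h2 := exists S v J, [/\ settled N T0 H0 S v h2, stable N T0 H0 S,
    forall e, e < i -> S (T0 e) || S (neg (T0 e)),
      hv h2 vJ = J /\ p = c * (N - v) &
    forall Sf, run N T0 H0 S [seq T0 e | e <- iota i (N - i)] (drop J g) Sf ->
      run N T0 H0 pred0 [seq T0 e | e <- iota 0 N] g Sf].
  apply: wp_weaken; first apply: (@wp_for I vC vN assign_literal N (c + casgn)
    (c * N) h1); last 1 first.
  + move=> t2 h2 fr2 [_ [q leq [S [v [J [st2 sb as_ [eJ eq] rn]]]]]]; split.
      move: lt0 (lt1 : t1 <= ecost 0) leq; rewrite /crun /c.
      move: casgn cprocess (fcost vN) (tcost _) (ecost _); clear; nia.
    exists S; split=> //; first by apply: rn; rewrite subnn.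
      by case: sb.
    by have := st_clean st2; rewrite fr2.1 // fr1.1 // fr0.1.
  + exists pred0, 0, 0; split=> //.
    - case: st1 => *; split=> //.
    - exact: run0_stable.
    - by rewrite subn0; split=> //; rewrite e1.
    - by move=> Sf; rewrite subn0 drop0.
  + by move=> i p h2 _ fr2 _; rewrite [LHS]fr2.1 // fr1.1 // fr0.1.
  move=> i p h2 lti fr2 vi [S [v [J [st2 sb as_ [eJ eq] rn]]]].
  have eT2 : ha h2 TL0 (hv h2 vC) = T0 i by rewrite fr2.2 // fr01 // eT vi.
  have eng2 : ha h2 NG (T0 i) = neg (T0 i) by rewrite fr2.2 // fr01 //;
    case: (ng _ lti).
  apply: wp_weaken (assign_literal_wp st2 eT2 eng2) _.
  move=> t3 h3 fr3 [S' [v' [u [s1 s2 s3 s4 s5]]]]; split;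
    first by rewrite fr3.1.
  have [sb' sub as'] := step_stable skew sb s1.
  exists (c * (N - v')).
    have := flow_le (st_cons s2) (st_flow s2); rewrite eq => lev'.
    have e3 : c * (N - v) = c * (N - v') + c * (v' - v).
      by rewrite -mulnDr; congr (_ * _); lia.
    by move: s5; rewrite -/c mulnS; lia.
  exists S', v', (J + u); split=> //.
  - case: s2 => *; split=> //.
  - move=> e; rewrite ltnS leq_eqVlt => /predU1P[-> //|lte].
    by case/orP: (as_ _ lte) => /sub ->; rewrite ?orbT.
  - by rewrite /= s4 eJ.
  - move=> Sf rS'; apply: rn; have -> : N - i = (N - i.+1).+1 by lia.
    exists S', u; split; last first.
      by move: rS'; case: (u) => /=; rewrite ?addn0 // -drop1 drop_drop addnC.
    move: s1; rewrite eJ fr2.2 // fr01 // bt -nth0 nth_drop addn0 eqb0 negbK.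
    by [].
- by [].
- by move=> i h1 _ fr _; apply: etrans eN; apply: fr.1.
move=> i h1 lti fr1 vi I1; apply: wp_weaken (wp_exec _ _) _ =>
  // t2 h2 fr2 [lt2 e2].
split=> //; first by rewrite fr2.1.
move=> e; rewrite ltnS e2 /= /upd vi.
case: eqP => [->|ne] lee; last by apply: I1; lia.
by rewrite (fr1.2 TL0) // (fr1.2 HD0) // eT eH.
Qed.

End Run.

(** * Building the implication graph *)

Definition field (j : nat) : hexp := IN.[vC + vC + vC + vC + vC + j].

(** [1 - field 2] flips a sign bit; a clause of size below two repeats its first literal, as in
    [lit2]. *)
Definition read_clause : cmd :=
  vX ::= field 1 + field 1 ;;
  vL ::= vX + field 2 ;;
  vNL ::= vX + (1 - field 2) ;;
  Test (field 0 - 1)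
    (vX ::= field 3 + field 3 ;;
     vW ::= vX + field 4 ;;
     vZ ::= vX + (1 - field 4))
    (vW ::= vL ;; vZ ::= vNL).

Definition write_arcs : cmd :=
  NG @ vL ::= vNL ;; NG @ vNL ::= vL ;;
  NG @ vW ::= vZ ;; NG @ vZ ::= vW ;;
  TL0 @ (vC + vC) ::= vNL ;; TL0 @ (vC + vC + 1) ::= vZ ;;
  Test (field 0)
    (HD0 @ (vC + vC) ::= vW ;; HD0 @ (vC + vC + 1) ::= vL)
    (HD0 @ (vC + vC) ::= vNL ;; HD0 @ (vC + vC + 1) ::= vZ).

Definition preprocess : cmd := For vC vM (read_clause ;; write_arcs).

Lemma nth_encoding (F : cnf) i j : is_2cnf F -> i < size F -> j < 5 ->
  nth 0 (flatten (map encode_clause F)) (i + i + i + i + i + j)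
  = nth 0 (encode_clause (nth [::] F i)) j.
Proof.
elim: F i => // c F IH i /andP[_ F2] lti ltj.
rewrite -[flatten _]/(encode_clause c ++ flatten (map encode_clause F)) nth_cat.
have -> : size (encode_clause c) = 5 by [].
case: i lti => [|i] lti; first by rewrite ltj.
have -> : (i.+1 + i.+1 + i.+1 + i.+1 + i.+1 + j < 5) = false by lia.
by rewrite -[RHS]IH //; congr nth; lia.
Qed.

Lemma code_field (l : literal) : l.1 + l.1 + (1 - l.2) = code (flip l).
Proof. by case: l => x []. Qed.

(** Writes to the table never conflict: the value written at [c] is always [neg c]. *)
Lemma upd_neg (f : nat -> nat) c d : f d = neg d -> upd f c (neg c) d = neg d.
Proof. by rewrite /upd; case: eqP => [->|]. Qed.

Lemma upd_negV (f : nat -> nat) c : upd f c (neg c) c = neg c.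
Proof. by rewrite /upd eqxx. Qed.

Lemma read_clause_exec F h i : is_2cnf F -> i < size F ->
  (forall j, ha h IN j = nth 0 (flatten (map encode_clause F)) j) ->
  hv h vC = i -> let c := nth [::] F i in let h' := exec read_clause h in
  [/\ ha h' = ha h, hv h' vC = i, hv h' vL = code (lit1 c) /\ hv h' vNL = code
    (flip (lit1 c)) &
      hv h' vW = code (lit2 c) /\ hv h' vZ = code (flip (lit2 c))].
Proof.
move=> F2 lti eIN vi /=.
have fld j : j < 5 -> ha h IN (i + i + i + i + i + j) = nth 0 (encode_clause
  (nth [::] F i)) j.
  by move=> ltj; rewrite eIN nth_encoding.
rewrite !vi !fld // [nth 0 _ 0]/= [nth 0 _ 1]/= [nth 0 _ 2]/= [nth 0 _ 3]/=
  [nth 0 _ 4]/=.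
have : size (nth [::] F i) <= 2 by apply: (all_nthP [::] F2).
by rewrite /lit2 /lit1; case: (nth [::] F i) => [|l1 [|l2 [|]]] //= _;
  rewrite ?vi; split=> //; split=> //; rewrite ?code_field.
Qed.

Definition neg_ok (F : cnf) (ng : nat -> nat) (i : nat) : Prop :=
  let c := nth [::] F i in
  [/\ ng (code (lit1 c)) = neg (code (lit1 c)),
      ng (code (flip (lit1 c))) = neg (code (flip (lit1 c))),
      ng (code (lit2 c)) = neg (code (lit2 c)) &
      ng (code (flip (lit2 c))) = neg (code (flip (lit2 c)))].

Lemma preprocess_wp F h : is_2cnf F -> hv h vM = size F ->
  (forall j, ha h IN j = nth 0 (flatten (map encode_clause F)) j) ->
  wp preprocess (fun t h' =>
    [/\ t <= size F * (tcost (read_clause ;; write_arcs) + fcost vM) + fcost vM,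
        implications F (ha h' TL0) (ha h' HD0) &
        forall i, i < size F -> neg_ok F (ha h' NG) i]) h.
Proof.
move=> F2 eM eIN.
pose I n h' := (forall i, i < n -> let c := nth [::] F i in
    [/\ ha h' TL0 (i + i) = code (flip (lit1 c)),
        ha h' TL0 (i + i + 1) = code (flip (lit2 c)),
        ha h' HD0 (i + i) = (if nilp c then ha h' TL0 (i + i) else code (lit2
          c)) &
        ha h' HD0 (i + i + 1) =
          (if nilp c then ha h' TL0 (i + i + 1) else code (lit1 c))]) /\
   (forall i, i < n -> neg_ok F (ha h' NG) i).
apply: wp_weaken; first apply: (@wp_for_simple I vC vM (read_clause ;;
  write_arcs)
  (size F) (tcost (read_clause ;; write_arcs)) h); last 1 first.
- by move=> t h' fr [_ lt [I1 I2]].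
- by [].
- by move=> i h' _ fr _; rewrite [LHS]fr.1.
move=> i h1 lti fr1 vi [I1 I2].
apply: wp_weaken (wp_exec _ _) _ => // t2 h2 fr2 [lt2 e2].
have eIN1 j : ha h1 IN j = nth 0 (flatten (map encode_clause F)) j
  by rewrite fr1.2.
have [eA eC [eL eNL] [eW eZ]] := read_clause_exec F2 lti eIN1 vi.
split=> //; first by rewrite e2 /=; case: ifP.
set hr := exec read_clause h1 in eA eC eL eNL eW eZ.
have e2' : h2 = exec write_arcs hr by [].
set c := nth [::] F i in eL eNL eW eZ.
have fl0 : ha hr IN (i + i + i + i + i + 0) = size c.
  by rewrite eA eIN1 nth_encoding.
have eNG : ha h2 NG = upd (upd (upd (upd (ha h1 NG) (code (lit1 c)) (neg (code
  (lit1 c))))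
     (code (flip (lit1 c))) (neg (code (flip (lit1 c))))) (code (lit2 c)) (neg
       (code (lit2 c))))
     (code (flip (lit2 c))) (neg (code (flip (lit2 c)))).
  have ff l : flip (flip l) = l by case: l => x []. 
  rewrite e2' !neg_code !ff; clearbody hr; rewrite /= ; case: ifP => _ /=;
    by rewrite eA eL eNL eW eZ.
have eTL : ha h2 TL0 = upd (upd (ha h1 TL0) (i + i) (code (flip (lit1 c))))
     (i + i + 1) (code (flip (lit2 c))).
  by rewrite e2'; clearbody hr; rewrite /= ; case: ifP => _ /=;
    rewrite eA eC eNL eZ.
have eHD : ha h2 HD0 = upd (upd (ha h1 HD0) (i + i)
      (if nilp c then code (flip (lit1 c)) else code (lit2 c)))
     (i + i + 1) (if nilp c then code (flip (lit2 c)) else code (lit1 c)).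
  rewrite e2'; clearbody hr; rewrite /= eC fl0 /nilp; case: eqP => _ /=;
    by rewrite eA ?eL ?eNL ?eW ?eZ ?eC.
clear e2 e2'.
split=> i' lti' /=.
  rewrite eTL eHD /upd; have -> : (i' + i' == i + i + 1) = false by lia.
  have -> : (i' + i' == i + i) = (i' == i) by lia.
  have -> : (i' + i' + 1 == i + i + 1) = (i' == i) by lia.
  have -> : (i' + i' + 1 == i + i) = false by lia.
  by case: eqP => [->|ne]; [split | apply: I1; lia].
rewrite eNG /neg_ok; case: (eqVneq i' i) => [->|ne].
  by rewrite -/c; split; do ?[by apply: upd_negV | apply: upd_neg].
have [|n1 n2 n3 n4] := I2 i'; first by lia.
by split; do 4!apply: upd_neg.
Qed.

Lemma neg_ok_table F h : implications F (ha h TL0) (ha h HD0) ->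
  (forall i, i < size F -> neg_ok F (ha h NG) i) ->
  neg_table0 (size F + size F) (ha h TL0) (ha h HD0) h.
Proof.
move=> imp ok e lte; pose i := e./2.
have lti : i < size F by rewrite /i; lia.
have [t1 t2 h1 h2] := imp _ lti; have [n1 n2 n3 n4] := ok _ lti.
have [-> | ->] : e = i + i \/ e = i + i + 1.
  by have := odd_double_half e; rewrite -/i -addnn; case: (odd e) => <-;
    [right | left]; rewrite /=; lia.
  by rewrite h1; case: ifP; rewrite t1.
by rewrite h2; case: ifP; rewrite t2.
Qed.

(** * Collecting violations and enumerating guesses *)

Definition record : cmd := OUT @ vCNT ::= vC ;; vCNT ::= vCNT + 1.

Definition check_clause : cmd :=
  Test (field 0)
    (Test (MK.[TL0.[vC + vC]] - (vSG + 1))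
       (Test (MK.[TL0.[vC + vC + 1]] - (vSG + 1)) record Pass)
       Pass)
    record.

Definition collect : cmd := vCNT ::= 0 ;; For vC vM check_clause.

Definition violations (F : cnf) (S : pred nat) : seq nat :=
  [seq i <- iota 0 (size F) | violated F S i].

Lemma collect_wp F S h : is_2cnf F -> hv h vM = size F ->
  (forall j, ha h IN j = nth 0 (flatten (map encode_clause F)) j) ->
  implications F (ha h TL0) (ha h HD0) -> clean (hv h vSG) S (ha h MK) ->
  wp collect (fun t h' => let D := violations F S in
    [/\ t <= ecost 0 + (size F * (tcost check_clause + fcost vM) + fcost vM),
        hv h' vCNT = size D & forall j, j < size D -> ha h' OUT j = nth 0 D j])
          h.
Proof.
move=> F2 eM eIN imp cl; apply: wp_then.
apply: wp_weaken (wp_exec _ _) _ => // t0 h0 fr0 [lt0 e0].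
pose D n := [seq i <- iota 0 n | violated F S i].
pose I n h1 := hv h1 vCNT = size (D n) /\
               forall j, j < size (D n) -> ha h1 OUT j = nth 0 (D n) j.
apply: wp_weaken; first apply: (@wp_for_simple I vC vM check_clause
  (size F) (tcost check_clause) h0); last 1 first.
- move=> t h' fr [_ lt [I1 I2]]; split=> //.
  by move: (lt0 : t0 <= ecost 0) lt; lia.
- by rewrite e0.
- by move=> i h' _ fr _; rewrite [LHS]fr.1 // fr0.1.
move=> i h1 lti fr1 vi [I1 I2].
apply: wp_weaken (wp_exec _ _) _ => // t2 h2 fr2 [lt2 e2].
have [eT1 eT2 _ _] := imp _ lti; set c := nth [::] F i in eT1 eT2.
have eF : ha h1 IN (i + i + i + i + i + 0) = size c.
  by rewrite fr1.2 // fr0.2 // eIN nth_encoding.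
have eS c' : S c' = (ha h1 MK c' - (hv h1 vSG + 1) != 0).
  rewrite fr1.2 // fr0.2 // fr1.1 // fr0.1 //; have [_ _ ->] := cl c'.
  by rewrite subn_eq0 -ltnNge.
have eT : ha h1 TL0 = ha h TL0 by rewrite fr1.2 // fr0.2.
have {}e2 : h2 = if violated F S i then exec record h1 else h1.
  rewrite e2 /violated -/c !eS /= vi eF eT eT1 eT2 /nilp.
  by case: eqP => //= _; case: eqP => //= _; case: eqP.
split=> //; first by rewrite fr2.1.
have eD : D i.+1 = if violated F S i then rcons (D i) i else D i.
  by rewrite /D -addn1 iotaD filter_cat /=; case: ifP; rewrite ?cats1 ?cats0.
rewrite /I eD e2; case: ifP => _ //=; rewrite vi I1 size_rcons addn1;
  split=> // j ltj.
rewrite /upd nth_rcons; case: ltngtP => [lj|lj|//]; last by lia.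
exact: I2.
Qed.

(** * Binary counter of guesses, least significant bit first *)

Fixpoint inc (g : seq bool) : seq bool :=
  match g with
  | [::] => [::]
  | b :: g' => ~~ b :: (if b then inc g' else g')
  end.

Fixpoint bval (g : seq bool) : nat :=
  match g with
  | [::] => 0
  | b :: g' => b + 2 * bval g'
  end.

Lemma size_inc g : size (inc g) = size g.
Proof. by elim: g => //= -[] g IH /=; rewrite ?IH. Qed.

(** The carry reaches a bit exactly when all lower bits are one. *)
Lemma nth_inc g i : i < size g ->
  nth false (inc g) i = nth false g i (+) all id (take i g).
Proof.
elim: g i => // b g IH [|i] /= lti; first by rewrite addbT.
by case: b => /=; rewrite ?addbF ?IH.
Qed.

Lemma bval_inc g :
  bval (inc g) = if all id g then 0 else (bval g).+1.
Proof.
by elim: g => //= -[] g /= IH //; rewrite IH; case: ifP => _; lia.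
Qed.

Lemma bval_all g : all id g -> (bval g).+1 = 2 ^ size g.
Proof. by elim: g => //= -[] g //= IH /IH; rewrite expnS; lia. Qed.

Lemma bval_lt g : bval g < 2 ^ size g.
Proof. by elim: g => //= -[] g IH; rewrite expnS; lia. Qed.

Lemma bval_inj g1 g2 : size g1 = size g2 -> bval g1 = bval g2 -> g1 = g2.
Proof.
elim: g1 g2 => [|b1 g1 IH] [|b2 g2] //= [es] ev.
have -> : b1 = b2 by move: ev; case: b1; case: b2 => //=; lia.
by congr cons; apply: IH => //; lia.
Qed.

Lemma bval_nseq n : bval (nseq n false) = 0.
Proof. by elim: n => //= n ->. Qed.

Definition flip_bit : cmd :=
  Test vY (Test BT.[vC] (BT @ vC ::= 0) (BT @ vC ::= 1 ;; vY ::= 0)) Pass.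

Definition increment : cmd := vY ::= 1 ;; For vC (vK + vK) flip_bit.

(** [vY] is the carry; it survives only the guess of all ones, the last in the enumeration. *)
Lemma increment_wp g h : size g = hv h vK + hv h vK ->
  (forall i, ha h BT i = nth false g i) ->
  wp increment (fun t h' =>
    [/\ t <= ecost 1 + (size g * (tcost flip_bit + fcost (vK + vK)) + fcost (vK
      + vK)),
        forall i, ha h' BT i = nth false (inc g) i & hv h' vY = all id g]) h.
Proof.
move=> sg bt; apply: wp_then; apply: wp_weaken (wp_exec _ _) _ =>
  // t0 h0 fr0 [lt0 e0].
pose I n h1 := hv h1 vY = all id (take n g) /\
   forall i, ha h1 BT i = nth false (if i < n then inc g else g) i.
apply: wp_weaken; first apply: (@wp_for_simple I vC (vK + vK)%hexp flip_bit
  (size g) (tcost flip_bit) h0); last 1 first.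
- move=> t h' fr [_ lt [I1 I2]]; split=> //.
  + by move: (lt0 : t0 <= ecost 1) lt; lia.
  + move=> i; rewrite I2; case: ltnP => // lei.
    by rewrite !nth_default // size_inc.
  by rewrite I1 take_size.
- by rewrite e0; split=> //=; rewrite take0.
- by move=> i h' _ fr _; rewrite /= fr.1 // fr0.1.
move=> n h1 ltn fr1 vn [I1 I2].
apply: wp_weaken (wp_exec _ _) _ => // t2 h2 fr2 [lt2 e2].
split=> //; first by rewrite fr2.1.
have tk : all id (take n.+1 g) = all id (take n g) && nth false g n.
  by rewrite (take_nth false) // all_rcons andbC.
have bn : ha h1 BT n = nth false g n by rewrite I2 ltnn.
have inn := nth_inc ltn.
have oth i : i != n -> (i < n.+1) = (i < n)
  by rewrite ltnS leq_eqVlt => /negPf->.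
move: e2; rewrite /flip_bit /= I1 vn bn.
case al: (all id (take n g)) inn tk => /=; last first.
  move=> inn tk ->; split; first by rewrite /= I1 tk al.
  move=> i /=; rewrite I2; case: (eqVneq i n) => [->|ne]; last by rewrite oth.
  by rewrite ltnSn ltnn inn addbF.
case gn: (nth false g n) => /= inn tk ->; split=> [|i] /=;
  rewrite ?tk ?I1 ?al //;
  rewrite /upd; (case: (eqVneq i n) => [->|ne];
    [by rewrite ltnSn inn | by rewrite oth // -I2]).
Qed.

(** * The main loop *)

Definition conclude : cmd := vRES ::= 1 ;; vGO ::= 0.
Definition stop : cmd := Test vY (vGO ::= 0) Pass.

(** Marks are at most [vSG + 2], so raising the stamp by 2 makes all of them stale at once. *)
Definition attempt : cmd :=
  guess_run ;; collect ;;
  (Test (vK + 1 - vCNT) conclude (increment ;; stop)) ;;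
  vSG ::= vSG + 2.

Definition main : cmd :=
  vN ::= vM + vM ;; preprocess ;; vGO ::= 1 ;; Loop vGO attempt.

Section Main.

Variables (F : cnf) (k : nat).
Hypothesis F2 : is_2cnf F.
Local Notation m := (size F).
Local Notation N := (m + m).

Definition fails (T H : nat -> nat) (g : seq bool) : Prop :=
  exists Sf, run N T H pred0 [seq T e | e <- iota 0 N] g Sf /\
             k < nviolated F Sf.

(** A solution gives [A] with [d0 A <= 2 k], hence by [run_complete] a guess all of whose runs end
    in a set contained in an assignment no worse than [A]; the failing run is one of them. *)
Lemma all_fail_unsolvable T H : implications F T H ->
  (forall g, size g = k + k -> fails T H g) ->
  ~ exists D, is_deletion_set F k D.
Proof.
move=> imp af [D /(deletion_set_violated F2)[A fA leA]].
have skew := outdeg_mirror imp.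
have stb := run0_stable N T H.
have leN : outdeg N T H A <= k + k + outdeg N T H pred0.
  by have := outdeg_violated imp fA; lia.
have [g sg hg] := run_complete skew [seq T e | e <- iota 0 N] stb
  (fun c (h : pred0 c) => match notF h with end) fA leN.
have [Sf [rn ltk]] := af _ sg; have [A' [cA' fA' leA']] := hg _ rn.
have := nviolated_mono imp fA' fA leA'.
have : nviolated F Sf <= nviolated F A'.
  apply: sub_count => i; rewrite /violated; case: (nilp _) => //= /andP[s1 s2].
  by have /andP[-> _] := cA' _ s1; have /andP[-> _] := cA' _ s2.
lia.
Qed.

Definition answered (h : hst) : Prop :=
  if hv h vRES == 0 then ~ exists D, is_deletion_set F k D
  else is_deletion_set F k (mkseq (ha h OUT) (hv h vCNT)).

Definition cattempt : nat := crun + ecost vGO + ecost 0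
  + (tcost check_clause + fcost vM) + fcost vM + ecost (vK + 1 - vCNT)
  + tcost conclude + ecost 1 + (tcost flip_bit + fcost (vK + vK)) + fcost (vK +
      vK)
  + tcost stop + ecost (vSG + 2).

(** The term [k + k] pays for advancing the counter of guesses. *)
Definition budget : nat := cattempt * (N.+1 * N.+1 * N.+1 + (k + k)).

(** Guesses below the counter have failed, and one share of the budget is kept for each of the
    others. *)
Definition pending (T H : nat -> nat) (p : nat) (h : hst) : Prop :=
  exists2 g, size g = k + k & [/\ forall i, ha h BT i = nth false g i,
    forall c, ha h MK c <= hv h vSG, hv h vGO != 0 /\ hv h vRES = 0,
    forall g', size g' = k + k -> bval g' < bval g -> fails T H g' &
    p = budget * (2 ^ (k + k) - bval g)].

Definition progress (T H : nat -> nat) (p : nat) (h : hst) : Prop :=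
  hv h vCNT <= m /\ (hv h vGO = 0 /\ answered h \/ pending T H p h).

Lemma attempt_wp p h : hv h vM = m -> hv h vK = k -> hv h vN = N ->
  (forall j, ha h IN j = nth 0 (flatten (map encode_clause F)) j) ->
  implications F (ha h TL0) (ha h HD0) ->
  neg_table0 N (ha h TL0) (ha h HD0) h ->
  hv h vGO != 0 -> progress (ha h TL0) (ha h HD0) p h ->
  wp attempt (fun t h' => exists2 q, ecost vGO + t + q <= p &
    progress (ha h TL0) (ha h HD0) q h') h.
Proof.
move=> eM eK eN eIN imp ngt go [_ [[go0 _]|]]; first by rewrite go0 in go.
move=> [g sg [bt mk [_ res] fl ep]].
have skew := outdeg_mirror imp.
apply: wp_then; apply: wp_weaken (guess_run_wp skew eN erefl erefl ngt mk bt) _.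
move=> t1 h1 fr1 [lt1 [Sf [rn cSf asg cl]]].
have eIN1 j : ha h1 IN j = nth 0 (flatten (map encode_clause F)) j
  by rewrite fr1.2.
have imp1 : implications F (ha h1 TL0) (ha h1 HD0) by rewrite !fr1.2.
have cl1 : clean (hv h1 vSG) Sf (ha h1 MK) by rewrite fr1.1.
have eM1 : hv h1 vM = m by rewrite fr1.1.
apply: wp_then; apply: wp_weaken (collect_wp F2 eM1 eIN1 imp1 cl1) _.
move=> t2 h2 fr2 [lt2 cnt out].
have nv : size (violations F Sf) = nviolated F Sf by rewrite size_filter.
have nvm : nviolated F Sf <= m by rewrite -[leqRHS](size_iota 0) count_size.
have blt : bval g < 2 ^ (k + k) by rewrite -sg bval_lt.
have ep2 : p = budget * (2 ^ (k + k) - (bval g).+1) + budget.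
  by rewrite ep -mulnSr; congr (_ * _); lia.
have eK2 : hv h2 vK = k by rewrite fr2.1 // fr1.1.
apply: wp_then; apply: wp_test => /= [ok|nok].
  apply: wp_weaken (wp_exec _ _) _ => // t3 h3 fr3 [lt3 e3].
  apply: wp_weaken (wp_exec _ _) _ => // t4 h4 fr4 [lt4 e4].
  exists 0.
    move: lt1 lt2 lt3 (lt4 : t4 <= ecost (vSG + 2));
      rewrite ep2 /budget /cattempt.
    move: (2 ^ _ - _) => z.
    move: crun (ecost _) (ecost _) (tcost check_clause) (fcost _) (ecost _)
      (tcost conclude) (ecost _) (tcost flip_bit) (fcost _) (tcost stop) (ecost
        _).
    by clear; nia.
  split; first by rewrite e4 e3 /= cnt nv.
  left; split; first by rewrite e4 e3.
  rewrite /answered e4 e3 /=.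
  have -> : mkseq (ha h2 OUT) (hv h2 vCNT) = violations F Sf.
    apply: (@eq_from_nth _ 0); rewrite size_mkseq ?cnt // => j ltj.
    by rewrite nth_mkseq // out.
  apply: violated_deletion_set => //; last first.
    by move: ok; rewrite eK2 cnt nv; lia.
  move=> i lti /=; have [e1 e2 _ _] := imp _ lti.
  by rewrite -e1 -e2 !asg //; lia.
apply: wp_then; have sg2 : size g = hv h2 vK + hv h2 vK by rewrite eK2.
have bt2 i : ha h2 BT i = nth false g i by rewrite fr2.2 // fr1.2.
apply: wp_weaken (increment_wp sg2 bt2) _ => t3 h3 fr3 [lt3 bt3 eY].
apply: wp_weaken (wp_exec _ _) _ => // t4 h4 fr4 [lt4 e4].
apply: wp_weaken (wp_exec _ _) _ => // t5 h5 fr5 [lt5 e5].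
have gfl : fails (ha h TL0) (ha h HD0) g.
  by exists Sf; split=> //; move: nok; rewrite eK2 cnt nv; lia.
have gle g' : size g' = k + k -> bval g' <= bval g -> fails (ha h TL0) (ha h
  HD0) g'.
  move=> sg'; rewrite leq_eqVlt => /predU1P[ev|]; last exact: fl.
  by rewrite (@bval_inj g' g) // sg.
exists (budget * (2 ^ (k + k) - (bval g).+1)).
  move: lt1 lt2 lt3 lt4 (lt5 : t5 <= ecost (vSG + 2));
    rewrite ep2 /budget /cattempt sg.
  move: (2 ^ _ - _) => z.
  move: crun (ecost _) (ecost _) (tcost check_clause) (fcost _) (ecost _)
    (tcost conclude) (ecost _) (tcost flip_bit) (fcost _) (tcost stop) (ecost
      _).
  by clear; nia.
have eCNT : hv h5 vCNT = size (violations F Sf).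
  by rewrite fr5.1 // fr4.1 // fr3.1.
have eRES : hv h5 vRES = 0 by rewrite fr5.1 // fr4.1 // fr3.1 // fr2.1 // fr1.1.
split; first by rewrite eCNT nv.
(* If the guess is all ones, it is the last, so every guess has failed and NO is correct. *)
case al: (all id g) eY => eY.
  left; split; first by rewrite fr5.1 // e4 /= eY.
  rewrite /answered eRES /=; apply: all_fail_unsolvable imp _ => g' sg'.
  apply: gle => //; have := bval_all al; have := bval_lt g'; rewrite sg sg';
    lia.
have ebv : bval (inc g) = (bval g).+1 by rewrite bval_inc al.
right; exists (inc g); first by rewrite size_inc.
split=> //.
- by move=> i; rewrite fr5.2 // fr4.2.
- move=> c; rewrite e5 /= fr4.2 // fr3.2 // fr2.2 // fr4.1 // fr3.1 // fr2.1 //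
    fr1.1 //.
  by have [] := cl c.
- split=> //; rewrite fr5.1 // e4 /= eY /=.
  by rewrite fr3.1 // fr2.1 // fr1.1.
- by move=> g' sg'; rewrite ebv ltnS; apply: gle.
- by rewrite ebv.
Qed.

Definition cmain : nat := ecost (vM + vM)
  + (tcost (read_clause ;; write_arcs) + fcost vM) + fcost vM + ecost 1 + ecost
      vGO.

Lemma main_wp h : hv h vM = m -> hv h vK = k ->
  (forall j, ha h IN j = nth 0 (flatten (map encode_clause F)) j) ->
  hv h vSG = 0 -> hv h vRES = 0 -> hv h vCNT = 0 ->
  (forall i, ha h BT i = 0) -> (forall i, ha h MK i = 0) ->
  wp main (fun t h' => [/\ t <= cmain * m.+1 + budget * 2 ^ (k + k),
                           hv h' vCNT <= m & answered h']) h.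
Proof.
move=> eM eK eIN eSG eRES eCNT eBT eMK.
apply: wp_then; apply: wp_weaken (wp_exec _ _) _ => // t0 h0 fr0 [lt0 e0].
have eM0 : hv h0 vM = m by rewrite fr0.1.
have eIN0 j : ha h0 IN j = nth 0 (flatten (map encode_clause F)) j
  by rewrite fr0.2.
apply: wp_then; apply: wp_weaken (preprocess_wp F2 eM0 eIN0) _ =>
  t1 h1 fr1 [lt1 imp ok].
have ngt := neg_ok_table imp ok.
apply: wp_then; apply: wp_weaken (wp_exec _ _) _ => // t2 h2 fr2 [lt2 e2].
apply: wp_weaken; first apply: (@wp_loop (progress (ha h2 TL0) (ha h2 HD0)) vGO
  attempt
  (budget * 2 ^ (k + k)) h2).
- move=> p h3 fr3 pr3 go.
  have eT : ha h3 TL0 = ha h2 TL0 by rewrite fr3.2.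
  have eH : ha h3 HD0 = ha h2 HD0 by rewrite fr3.2.
  rewrite -eT -eH; apply: attempt_wp => //.
  + by rewrite fr3.1 // fr2.1 // fr1.1.
  + by rewrite fr3.1 // fr2.1 // fr1.1 // fr0.1.
  + by rewrite fr3.1 // fr2.1 // fr1.1 // e0 /= eM.
  + by move=> j; rewrite fr3.2 // fr2.2 // fr1.2.
  + by rewrite !fr3.2 // !fr2.2.
  + by rewrite /neg_table0 !fr3.2 // !fr2.2.
  + by rewrite eT eH.
- split; first by rewrite fr2.1 // fr1.1 // fr0.1 // eCNT.
  right; exists (nseq (k + k) false); first by rewrite size_nseq.
  split.
  + move=> i; rewrite nth_nseq if_same fr2.2 // fr1.2 // fr0.2 //.
  + by move=> c; rewrite fr2.2 // fr1.2 // fr0.2 // eMK.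
  + by rewrite e2 /= fr1.1 // fr0.1.
  + by move=> g' _; rewrite bval_nseq.
  + by rewrite bval_nseq subn0.
move=> t h' fr [/= go0 [q leq [cntm pr]]]; split=> //.
  move: lt0 lt1 lt2 leq; rewrite -/(ecost (vM + vM)) [tcost (vN ::= _)]/=
    [tcost (vGO ::= _)]/= /cmain.
  move: (budget * _) (ecost _) (ecost _) (fcost _) (tcost _) (ecost _).
  by clear; nia.
by case: pr => [[]|[g _ [_ _ [/negP go _] _ _]]] //; case: go; rewrite go0.
Qed.
End Main.

(** * Input, output and the running time *)

(* Register 30 is not used by the compiled variables. *)
Definition copy_loop (r : nat) (a e : expr) : prog :=
  While (Sub (Reg r) (Reg 30))
    (Seq (Store a e) (Assign 30 (Add (Reg 30) (Const 1)))).

Definition ccopy (a e : expr) : nat := cost a + cost e + 10.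

Lemma copy_loop_runs r a e R (n : nat) (I : nat -> (nat -> nat) -> Prop) M :
  r != 30 -> R r = n -> I 0 M ->
  (forall i M', i < n -> I i M' -> let s := State (upd R 30 i) M' in
     I i.+1 (upd M' (eval s a) (eval s e))) ->
  exists t M', [/\ runs (copy_loop r a e) (State (upd R 30 0) M) t
                     (State (upd R 30 n) M'), t <= ccopy a e * n.+1 & I n M'].
Proof.
move=> nr eR I0 step.
suff gen j i M1 : i + j = n -> I i M1 -> exists t M',
    [/\ runs (copy_loop r a e) (State (upd R 30 i) M1) t (State (upd R 30 n)
      M'),
        t <= ccopy a e * j.+1 & I n M'] by exact: gen I0.
elim: j i M1 => [|j IH] i M1 eij Ii.
  exists (cost (Sub (Reg r) (Reg 30))).+1, M1; split.
  - have -> : i = n by lia.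
    by apply: RunWhileFalse; rewrite /= /upd eqxx (negPf nr) eR subnn.
  - by rewrite muln1 /ccopy /=; lia.
  - by have <- : i = n by lia.
have lti : i < n by lia.
have [|t [M' [rn lt In]]] := IH i.+1 _ _ (step _ _ lti Ii); first by lia.
set s := State (upd R 30 i) M1 in rn.
exists (cost (Sub (Reg r) (Reg 30)) + ((cost a + cost e).+1
  + (cost (Add (Reg 30) (Const 1))).+1) + t).+1, M'; split=> //.
  apply: (RunWhileTrue (s2 := State (upd R 30 i.+1) (upd M1 (eval s a) (eval s
    e)))).
  - by rewrite /= /upd eqxx (negPf nr) eR; lia.
  - apply: RunSeq; first exact: RunStore.
    have <- : upd (upd R 30 i) 30 (upd R 30 i 30 + 1) = upd R 30 i.+1.
      apply: functional_extensionality => x.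
      by rewrite /upd; case: (x == 30); rewrite ?addn1.
    exact: RunAssign.
  - exact: rn.
rewrite [cost (Sub _ _)]/= [cost (Add _ _)]/= mulnS; move: lt; rewrite /ccopy;
  lia.
Qed.

(** [m] already sits in the register of [vM], and [k] moves to that of [vK]; register 0 becomes the
    base [5 m], just above the input, where memory is still zero. *)
Definition prologue : prog :=
  Seq (Assign 2 (Reg 0))
    (Seq (Assign 0 (scale 5 (Reg 1))) (copy_loop 0 (address IN (Reg 30)) (Cell
      (Reg 30)))).

Definition cell_count : nat := (vcode vCNT).+1.
(** Register 0 keeps the base address until [OUT] has been copied, and is overwritten last. *)
Definition epilogue : prog :=
  Seq (Assign 30 (Const 0))
    (Seq (copy_loop cell_count (Reg 30) (Cell (address OUT (Reg 30))))
       (Seq (Assign 1 (Reg cell_count)) (Assign 0 (Reg (vcode vRES).+1)))).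

Definition initial (F : cnf) (k : nat) : hst :=
  Hst (fun v => match v with vM => size F | vK => k | _ => 0 end)
      (fun a i => if acode a == acode IN
                  then nth 0 (flatten (map encode_clause F)) i else 0).

Lemma size_encoding F : size (flatten (map encode_clause F)) = 5 * size F.
Proof. by elim: F => //= c F ->; lia. Qed.

Definition cprologue : nat :=
  ccopy (address IN (Reg 30)) (Cell (Reg 30)) + cost (scale 5 (Reg 1)) + 10.

Lemma prologue_runs F k : exists t s,
  [/\ runs prologue (input_state F k) t s, t <= cprologue * (5 * size F).+1 &
      represents (5 * size F) (initial F k) s].
Proof.
set B := 5 * size F; set enc := nth 0 (flatten (map encode_clause F)).
pose R := upd (upd (nth 0 [:: k; size F]) 2 k) 0 B.
have eR : upd R 30 0 = R.
  apply: functional_extensionality => x; rewrite /upd; case: eqP => // ->.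
  by rewrite /R /upd.
(* All writes go to addresses from [B] on, so the source stays intact. *)
pose I i (M : nat -> nat) := (forall a, a < B -> M a = enc a) /\
  (forall a j, M (B + 11 * j + acode a) =
     if (acode a == acode IN) && (j < i) then enc j else 0).
have enc0 a : B <= a -> enc a = 0 by move=> le;
  rewrite /enc nth_default // size_encoding.
have [||||t [M' [rn lt [_ I2]]]] := @copy_loop_runs 0 (address IN (Reg 30))
  (Cell (Reg 30))
  R B I enc; [by [] | by rewrite /R /upd | |  |].
- split=> // a j; rewrite ltn0 andbF enc0 //; lia.
- move=> i M lti [I1 I2] s.
  have eA : eval s (address IN (Reg 30)) = B + 11 * i + acode IN.
    by rewrite eval_address.
  have eE : eval s (Cell (Reg 30)) = enc i by rewrite -I1.
  rewrite eA eE; split.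
    by move=> a lta; rewrite /upd ifN ?I1 //; apply/eqP; lia.
  move=> a j; rewrite /upd I2; have := acode_lt a; have := acode_lt IN.
  case: (acode a =P acode IN) => [->|ne] l1 l2 /=.
    have -> : (B + 11 * j + 9 == B + 11 * i + 9) = (j == i) by lia.
    by case: eqP => [->|ne]; [rewrite ltnSn | have -> : (j < i.+1) = (j < i) by
      lia].
  by rewrite ifN //; apply/eqP; move: ne; rewrite /=; lia.
have rB : runs (Assign 0 (scale 5 (Reg 1)))
    (State (upd (nth 0 [:: k; size F]) 2 k) enc) (cost (scale 5 (Reg 1))).+1
    (State R enc).
  by have := RunAssign (State (upd (nth 0 [:: k; size F]) 2 k) enc) 0
    (scale 5 (Reg 1)); rewrite eval_scale.
rewrite eR in rn.
eexists _, _; split.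
- by apply: RunSeq; [exact: RunAssign | apply: RunSeq rB rn].
- rewrite [cost (Reg 0)]/=; move: lt; rewrite /cprologue -/B.
  by move: (ccopy _ _) (cost _) => u v lt'; clear - lt'; nia.
split.
- by rewrite /= /upd.
- by case.
move=> a i; have := I2 a i; rewrite /= => ->; case: (acode a == 9) => //=.
by case: ltnP => // le; exact: esym (enc0 _ le).
Qed.

Definition cepilogue : nat := ccopy (Reg 30) (Cell (address OUT (Reg 30))) + 10.

(** With at most [B] entries, the answer is written below the base address and cannot overwrite
    [OUT]. *)
Lemma epilogue_runs B h s : represents B h s -> hv h vCNT <= B ->
  exists t s', [/\ runs epilogue s t s', t <= cepilogue * (hv h vCNT).+1 &
    [/\ reg s' 0 = hv h vRES, reg s' 1 = hv h vCNT &
        forall j, j < hv h vCNT -> mem s' j = ha h OUT j]].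
Proof.
move=> rep le; have [rB rv ra] := rep; case: s rB rv ra rep =>
  R M /= rB rv ra rep.
set n := hv h vCNT in le *.
pose I i (M' : nat -> nat) := (forall j, j < i -> M' j = ha h OUT j) /\
  forall a j, M' (B + 11 * j + acode a) = ha h a j.
have [||||t [M' [rn lt [I1 _]]]] := @copy_loop_runs cell_count (Reg 30)
  (Cell (address OUT (Reg 30))) R n I M; [by [] | exact: (rv vCNT) |
    by [] |  |].
  move=> i M1 lti [I1 I2] s1.
  have eE : eval s1 (Cell (address OUT (Reg 30))) = ha h OUT i.
    have -> : eval s1 (Cell (address OUT (Reg 30))) = M1 (eval s1 (address OUT
      (Reg 30))) by [].
    rewrite -(I2 OUT); congr M1.
    by rewrite eval_address /= {1}/upd /= rB /upd eqxx.
  have eA : eval s1 (Reg 30) = i by rewrite /= /upd eqxx.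
  rewrite eE eA; split.
    by move=> j; rewrite /upd; case: eqP => [-> //|ne lej]; apply: I1; lia.
  move=> a j; rewrite /upd ifN ?I2 //; apply/eqP; lia.
eexists _, _; split.
- apply: RunSeq; first exact: RunAssign.
  apply: RunSeq; first exact: rn.
  by apply: RunSeq; exact: RunAssign.
- rewrite /=; move: lt; rewrite /cepilogue.
  by move: (ccopy _ _) => u lt'; clear - lt'; nia.
split=> //=.
- by rewrite /upd /= (rv vRES).
- by rewrite /upd /= (rv vCNT).
Qed.

(** The constant is [29 = 3 ^ 3 + 2], from [2 m + 1 <= 3 y] and [2 k <= 2 x]. *)
Lemma budget_bound F k :
  budget F k * 2 ^ (k + k) <= 29 * cattempt * (15 ^ k * maxn k 1 * maxn (size
    F) 1 ^ 3).
Proof.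
rewrite /budget; set m := size F; set x := maxn k 1; set y := maxn m 1.
have p15 : 2 ^ (k + k) <= 15 ^ k.
  rewrite addnn -mul2n expnM.
  by case: (k) => // k'; rewrite leq_exp2r.
have y3 : 0 < y ^ 3 by rewrite expn_gt0 /y leq_max orbT.
have le1 : (m + m).+1 * (m + m).+1 * (m + m).+1 <= 27 * y ^ 3.
  have -> : 27 * y ^ 3 = (3 * y) * (3 * y) * (3 * y) by rewrite !expnS expn0;
    lia.
  by rewrite !leq_mul // /y; lia.
have le2 : (m + m).+1 * (m + m).+1 * (m + m).+1 + (k + k) <= 29 * (x * y ^ 3).
  have kx : k <= x by rewrite leq_maxl.
  have x1 : 0 < x by rewrite leq_max orbT.
  by move: le1 y3 kx x1; move: (_ * _ * _) (y ^ 3) x => a b c; clear; nia.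
have := leq_mul (leq_mul (leqnn cattempt) le2) p15.
by congr (_ <= _); lia.
Qed.

(* The factors k and m are read as maxn k 1 and maxn m 1: literally, the bound
   would be 0 steps when k = 0 or m = 0. *)
Theorem theorem7 :
  exists (p : prog) (C : nat), forall (F : cnf) (k : nat), is_2cnf F ->
    exists (t : nat) (s : state),
      [/\ runs p (input_state F k) t s,
          correct_answer F k (output s) &
          t <= C * (15 ^ k * maxn k 1 * maxn (size F) 1 ^ 3)].
Proof.
exists (Seq prologue (Seq (comp main) epilogue)).
(* The factors come from [5 m + 1 <= 10 X] and [m + 1 <= 2 X], where [X] is the bound without
   [C]. *)
exists (10 * cprologue + 2 * cmain + 29 * cattempt + 2 * cepilogue) => F k F2.
have [t1 [s1 [r1 lt1 rep1]]] := prologue_runs F k.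
have [||||||||t2 [h2 [hr2 [lt2 cnt2 ans2]]]] :=
  @main_wp F k F2 (initial F k) => //.
have [s2 r2 rep2] := comp_runs hr2 rep1.
have [|t3 [s3 [r3 lt3 [e0 e1 em]]]] := epilogue_runs rep2; first by lia.
exists (t1 + (t2 + t3)), s3; split.
- by apply: RunSeq r1 _; apply: RunSeq r2 r3.
- move: ans2; rewrite /output e0 e1 /answered; case: eqP => //= _.
  suff -> : mkseq (ha h2 OUT) (hv h2 vCNT) = mkseq (mem s3) (hv h2 vCNT) by [].
  by apply/eq_in_map => j; rewrite mem_iota => /= /em.
have lb := budget_bound F k.
set X := 15 ^ k * _ * _ in lb *.
have leX : (size F).+1 <= 2 * X.
  have p : 0 < 15 ^ k * maxn k 1 by rewrite muln_gt0 expn_gt0 leq_max orbT.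
  have le3 : maxn (size F) 1 <= maxn (size F) 1 ^ 3.
    by rewrite -[leqLHS]expn1 leq_pexp2l // leq_max orbT.
  by have := leq_mul p le3; rewrite -/X; lia.
have {}lt1 : t1 <= cprologue * (10 * X).
  by apply: leq_trans lt1 _; apply: leq_mul => //; lia.
have {}lt3 : t3 <= cepilogue * (2 * X).
  by apply: leq_trans lt3 _; apply: leq_mul => //; lia.
have lm : cmain * (size F).+1 <= cmain * (2 * X) by apply: leq_mul.
by rewrite !mulnDl; lia.
Qed.
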